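(* Let $a,b,c,d\in\mathbb{R}$ with $d\neq 0$, and consider the differential system in $\mathbb{R}^3$ $$\dot{x}=a(y-x)+yz,\qquad \dot{y}=bx+cy-xz,\qquad \dot{z}=-dz+xy+1,$$ with its singular point $E_1=\left(0,0,\tfrac1d\right)$. If $a=c$ and $(1+cd)(1-bd)-c^2d^2>0$, then $E_1$ is a Hopf point of the system. Furthermore, under these conditions ($d\neq0$, $a=c$ and $(1+cd)(1-bd)-c^2d^2>0$), the Hopf point $E_1$ is a center on the center manifold of the system if and only if $b=c=0$, and in that case it is not an isochronous center.
   Context: A singular point of a differential system in $\mathbb{R}^3$ is a Hopf point if the Jacobian matrix of the vector field at that point has a pair of (nonzero) purely imaginary eigenvalues and one nonzero real eigenvalue. At a Hopf point $p$, for every $r\in\mathbb{N}$ there is a (local) invariant two-dimensional manifold $W^c$ of class $\mathcal{C}^r$ through $p$, tangent at $p$ to the plane spanned by the real and imaginary parts of the eigenvectors of the purely imaginary eigenvalues; it is called a center manifold. The singular point $p$ is either a center or a focus for the system restricted to $W^c$. It is a center on the center manifold if all orbits on $W^c$ in a punctured neighborhood of $p$ are periodic orbits surrounding $p$. It is a focus on the center manifold if all orbits on $W^c$ in a punctured neighborhood of $p$ spiral towards $p$ in forward time, or all do so in backward time. A center on the center manifold is isochronous if its period function is constant, that is, all periodic orbits on $W^c$ in a neighborhood of $p$ have the same period. *)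

(* Defs.v *)
From HB Require Import structures.
From mathcomp Require Import all_boot all_order all_algebra.
From mathcomp Require Import complex.
From mathcomp Require Import all_classical all_reals all_analysis.

Set Implicit Arguments.
Unset Strict Implicit.
Unset Printing Implicit Defensive.

Import Order.TTheory GRing.Theory Num.Theory.
Import numFieldNormedType.Exports.

Local Open Scope classical_set_scope.
Local Open Scope ring_scope.

Section Dynamics.
Variable R : realType.
Local Notation E := 'rV[R]_3.
Implicit Types (f : E -> E) (p q : E) (W U : set E) (g : R -> E).

Definition cjacobian f p : 'M[R[i]]_3 :=
  map_mx (real_complex R) (jacobian f p).

(* The three eigenvalues are distinct, hence they exhaust the spectrum.
   [jacobian] acts on row vectors from the right, as does [eigenvalue]. *)
Definition hopf_point f p : Prop :=
  f p = 0 /\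
  exists w m : R,
    [/\ w != 0, m != 0,
        eigenvalue (cjacobian f p) (Complex 0 w),
        eigenvalue (cjacobian f p) (Complex 0 (- w))
      & eigenvalue (cjacobian f p) (Complex m 0)].

(* For [v] an eigenvector to the eigenvalue [i w], this is the span of the real
   and imaginary parts of [v]; all such [v] span the same plane when [p] is a
   Hopf point, and [v = 0] only contributes the origin. *)
Definition center_plane f p : set E :=
  [set u | exists (w : R) (v : 'rV[R[i]]_3) (s t : R),
    [/\ w != 0, v *m cjacobian f p = Complex 0 w *: v
      & u = s *: map_mx (@complex.Re R) v + t *: map_mx (@complex.Im R) v]].

(* Only values on [I] matter; [I] is meant to be open. *)
Definition solution_on f (I : set R) g : Prop :=
  forall t : R, I t -> is_derive t (1 : R) g (f (g t)).

Fixpoint class_C (r : nat) U (F : E -> R) : Prop :=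
  match r with
  | 0 => forall q, U q -> {for q, continuous F}
  | r'.+1 => (forall q, U q -> differentiable F q) /\
      forall i : 'I_3, class_C r' U (fun q => 'D_(delta_mx 0 i) F q)
  end.

(* Local level sets of C^r submersions to R, i.e. embedded 2-manifolds. *)
Definition C_surface (r : nat) W : Prop :=
  forall q, W q -> exists U (F : E -> R),
    [/\ open U, U q, class_C r U F,
        (forall u, U u -> exists v, 'd F u v != 0)
      & W `&` U = [set u | U u /\ F u = 0]].

Definition tangent_space W q : set E :=
  [set v | exists g : R -> E,
    [/\ g 0 = q, (\forall t \near (0 : R), W (g t))
      & is_derive (0 : R) (1 : R) g v]].

(* A solution starting on [W] stays on [W], in forward and backward time, for
   as long as it stays in a fixed neighborhood [U] of [p]. *)
Definition locally_invariant f p W : Prop :=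
  exists U, [/\ open U, U p &
    forall (g : R -> E) (s t : R), s < 0 -> 0 < t ->
      solution_on f [set u | s < u < t] g ->
      (forall u, s < u < t -> U (g u)) ->
      W (g 0) -> forall u, s < u < t -> W (g u)].

Definition center_manifold (r : nat) f p W : Prop :=
  [/\ W p, C_surface r W, tangent_space W p = center_plane f p
    & locally_invariant f p W].

Definition least_period g (T : R) : Prop :=
  [/\ 0 < T, (forall t, g (t + T) = g t)
    & forall s, 0 < s < T -> g s <> g 0].

(* The closed curve [G] is the boundary, relative to [W], of a compact region
   [K] of [W] inside [N] that contains [p] in its relative interior. *)
Definition surrounds W (N : set E) p (G : set E) : Prop :=
  exists K : set E,
    [/\ compact K, K `<=` W `&` N, G `<=` K, (K `\` G) p
      & exists U, open U /\ K `\` G = W `&` U].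

(* Quantifying over arbitrarily small neighborhoods [N] keeps the region
   enclosed by a periodic orbit in the part of [W] near [p], where [W] is a
   disc and "surrounding" is unambiguous. *)
Definition center_on f p W : Prop :=
  forall N, nbhs p N -> exists V, nbhs p V /\
    forall q, W q -> V q -> q <> p ->
      exists (g : R -> E) (T : R),
        [/\ solution_on f setT g, g 0 = q, least_period g T
          & surrounds W N p (range g)].

Definition isochronous_center_on f p W : Prop :=
  center_on f p W /\
  exists (T : R) (V : set E), nbhs p V /\
    forall q, W q -> V q -> q <> p ->
      forall (g : R -> E) (T' : R),
        solution_on f setT g -> g 0 = q -> least_period g T' -> T' = T.

Definition vfield (a b c d : R) (p : E) : E :=
  let x := p 0 0 in let y := p 0 1 in let z := p 0 2 in
  \row_(i < 3) [:: a * (y - x) + y * z;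
                   b * x + c * y - x * z;
                   - d * z + x * y + 1]`_i.

Definition E1 (d : R) : E := \row_(i < 3) [:: 0; 0; 1 / d]`_i.

End Dynamics.

(* Main.v *)
Require Import Defs.
From mathcomp Require Import all_boot all_order all_algebra.
From mathcomp Require Import complex ring lra.
From mathcomp Require Import all_classical all_reals all_analysis.

Import Order.TTheory GRing.Theory Num.Theory.
Import numFieldNormedType.Exports.

Local Open Scope classical_set_scope.
Local Open Scope ring_scope.

Set Implicit Arguments.
Unset Strict Implicit.
Unset Printing Implicit Defensive.

(** Write [w = z - 1 / d]. The linear part at [E1] is a planar linear part of
    trace zero, of positive determinant by the hypothesis, plus the eigenvalue
    [- d]: this is a Hopf point, and the center plane is the horizontal plane.

    A center forces [b = c = 0]. The quadratic terms [(y * w, - x * w)] rotate the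
    plane, so the quadratic forms in [(x, y)] and the variable [w] satisfy a closed
    quadratic system ([orbit_reduced]), in which twice the Hamiltonian of the
    linear planar part, called [h], is constant to first order. Averaging yields a
    polynomial [V = h + ...] whose derivative along the flow is definite on a full
    neighborhood of [E1] in space, not only on a center manifold: to the order
    [h ^ 2] when the first Lyapunov coefficient is nonzero ([reduced_lyapunov1]),
    and to the order [h ^ 3] when it vanishes, because the second coefficient is
    then nonzero unless [b = c = 0] ([reduced_lyapunov2]). A periodic function
    that is monotone is constant, so that no periodic orbit other than [E1]
    remains near [E1], whereas a center would provide some ([center_orbit]).

    Now let [b = c = 0]. Then [x ^ 2 + y ^ 2] is conserved and [(x, y)] rotates with
    speed [z]. An exact identity expresses the angle gained over a period [T] as
    [T / d] minus [d] times the integral of [w ^ 2] ([orbit_period]). This angle is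
    a multiple of [2 * pi] and the integral is positive and tends to zero with the
    orbit, so that the period cannot be constant ([not_isochronous]).

    For the existence of the center, a center manifold is near [E1] a graph over
    the horizontal plane ([local_graph]). On the cylinder through a point of the
    manifold the system in the angle and [w] is globally Lipschitz, hence has
    solutions for all times ([picard_lindelof]). Local invariance keeps such a
    solution on the graph and [w] small ([confined]); the angle then makes a full
    turn, after which the graph property returns [w] to its initial value, and
    uniqueness makes the solution periodic ([center_bc0]). *)

(** * Calculus on the real line *)

Lemma is_derive_coord (R : realType) (g : R -> 'rV[R]_3) (t : R) v i j :
  is_derive t (1 : R) g v -> is_derive t (1 : R) (fun s => g s i j) (v i j).
Proof.
move=> [gd gv].
have gdij := (derivable_mxP g t 1).1 gd i j.
by apply: DeriveDef => //; rewrite -gv derive_mx // mxE.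
Qed.

Lemma is_derive_rV (R : realType) (g : R -> 'rV[R]_3) (t : R) (v : 'rV[R]_3) :
  (forall j, is_derive t (1 : R) (fun s => g s 0 j) (v 0 j)) ->
  is_derive t (1 : R) g v.
Proof.
move=> gj.
have gd : derivable g t 1.
  by apply/derivable_mxP => i j; rewrite (ord1 i); exact: @ex_derive.
apply: DeriveDef => //; rewrite derive_mx //.
by apply/rowP => j; rewrite !mxE; apply: derive_val.
Qed.

Lemma is_derive_continuous (R : realType) (f : R -> R) (t l : R) :
  is_derive t (1 : R) f l -> {for t, continuous f}.
Proof.
move=> fd; apply: differentiable_continuous.
by apply/derivable1_diffP; exact: @ex_derive.
Qed.

Lemma is_derive_MVT (R : realType) (f df : R -> R) (a b : R) :
  (forall t, is_derive t (1 : R) f (df t)) -> a <= b ->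
  exists2 c, a <= c <= b & f b - f a = df c * (b - a).
Proof.
move=> fd ab.
have fc : {within `[a, b], continuous f}.
  by apply: continuous_subspaceT => x; exact: is_derive_continuous (fd x).
have [c cab e] := MVT_segment ab (fun x _ => fd x) fc.
by exists c => //; rewrite in_itv /= in cab.
Qed.

Lemma ndecr_is_derive_ge0 (R : realType) (f df : R -> R) :
  (forall t, is_derive t (1 : R) f (df t)) -> (forall t, 0 <= df t) ->
  {homo f : x y / x <= y}.
Proof.
move=> fd df0 x y xy; have [c _ e] := is_derive_MVT fd xy.
by rewrite -subr_ge0 e mulr_ge0 // subr_ge0.
Qed.

(** A monotone periodic function is constant. *)
Lemma periodic_ge0_derive (R : realType) (f df : R -> R) (T : R) :
  0 < T -> (forall t, f (t + T) = f t) ->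
  (forall t, is_derive t (1 : R) f (df t)) -> (forall t, 0 <= df t) ->
  forall t, df t = 0.
Proof.
move=> T0 fT fd df0 t.
have fm := ndecr_is_derive_ge0 fd df0.
have fTn n x : f (x + n%:R * T) = f x.
  elim: n => [|n IH]; first by rewrite mul0r addr0.
  by rewrite -natr1 mulrDl mul1r addrA fT.
have fc : f = cst (f t).
  apply/funext => x /=.
  have le x' y' : f x' <= f y'.
    have [xy|yx] := leP x' y'; first exact: fm.
    pose n := (Num.truncn ((x' - y') / T)).+1.
    rewrite -(fTn n y'); apply: fm; rewrite -lerBlDl -ler_pdivrMr //.
    by apply/ltW/(lt_le_trans (truncnS_gt _)).
  by apply/eqP; rewrite eq_le !le.
have := @derive_val _ _ _ _ _ _ _ (fd t); rewrite fc => <-.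
exact: derive_cst.
Qed.

(** The differentiation rules for explicit lambda-expressions: the instances on
    the ring of functions do not see through [fun s => f s + g s], whereas
    [derive_tac] reduces such a derivative to an identity between its values. *)
Section DerivationRules.
Variables (R : realType) (V : normedModType R).
Implicit Types (f g : V -> R) (x v : V) (a b k : R).

Lemma der_id (t : R) : is_derive t (1 : R) (fun s : R => s) 1.
Proof. exact: is_derive_id. Qed.

Lemma der_cst x v k : is_derive x v (fun _ : V => k) 0.
Proof. exact: is_derive_cst. Qed.

Lemma der_D f g x v a b : is_derive x v f a -> is_derive x v g b ->
  is_derive x v (fun s => f s + g s) (a + b).
Proof. exact: is_deriveD. Qed.

Lemma der_N f x v a : is_derive x v f a ->
  is_derive x v (fun s => - f s) (- a).
Proof. exact: is_deriveN. Qed.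

Lemma der_M f g x v a b : is_derive x v f a -> is_derive x v g b ->
  is_derive x v (fun s => f s * g s) (f x * b + g x * a).
Proof. exact: is_deriveM. Qed.

Lemma der_Z k f x v a : is_derive x v f a ->
  is_derive x v (fun s => k * f s) (k * a).
Proof. exact: is_deriveZ. Qed.

Lemma der_comp (h f : R -> R) (t : R) a b : is_derive (f t) (1 : R) h a ->
  is_derive t (1 : R) f b -> is_derive t (1 : R) (fun s => h (f s)) (a * b).
Proof. exact: is_derive1_comp. Qed.

Lemma der_eq f x v a b : is_derive x v f a -> a = b -> is_derive x v f b.
Proof. by move=> fa <-. Qed.

End DerivationRules.

Ltac derive_step := first
  [ eassumption | eapply der_cst | eapply der_id
  | eapply der_N; derive_step
  | eapply der_D; [derive_step | derive_step]
  | eapply der_Z; derive_step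
  | eapply der_M; [derive_step | derive_step] ].
Ltac derive_tac := eapply der_eq; [derive_step | cbv beta].

(** * Lyapunov functions for the reduced quadratic system *)

Section Order.
Variables (R : realType) (T : Type) (A : set T) (e : T -> R).

(** This replaces explicit bounds on the coefficients of the error terms: the
    thresholds below only need some constant, independent of the orbit. *)
Definition order_ge (k : nat) (f : T -> R) :=
  exists2 C : R, 0 <= C & forall v, A v -> `|f v| <= C * e v ^+ k.

Lemma order_geD k f g :
  order_ge k f -> order_ge k g -> order_ge k (fun v => f v + g v).
Proof.
move=> [C C0 fC] [C' C'0 gC]; exists (C + C'); first exact: addr_ge0.
move=> v Av; rewrite mulrDl (le_trans (ler_normD _ _)) // lerD //.
  exact: fC.
exact: gC.
Qed.

Lemma order_geZ k c f : order_ge k f -> order_ge k (fun v => c * f v).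
Proof.
move=> [C C0 fC]; exists (`|c| * C); first by rewrite mulr_ge0.
by move=> v Av; rewrite normrM -mulrA ler_wpM2l // fC.
Qed.

Lemma order_geN k f : order_ge k f -> order_ge k (fun v => - f v).
Proof. by move=> [C C0 fC]; exists C => // v Av; rewrite normrN fC. Qed.

Lemma order_geM k f g :
  order_ge 1 f -> order_ge k g -> order_ge k.+1 (fun v => f v * g v).
Proof.
move=> [C C0 fC] [C' C'0 gC]; exists (C * C'); first exact: mulr_ge0.
move=> v Av; rewrite normrM exprS mulrACA ler_pM //; last exact: gC.
by have := fC v Av; rewrite expr1.
Qed.

End Order.

Ltac order_ge_tac := repeat first [assumption | apply: order_geN
  | apply: order_geD | apply: order_geZ | apply: order_geM].

Section ReducedSystem.
Variable R : realType.
Variables (d sg Dl Om mu nu : R).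
Hypotheses (d_neq0 : d != 0) (Dl_gt0 : 0 < Dl) (Om_gt0 : 0 < Om).
Hypothesis Om_def : Om = sg ^+ 2 - Dl.

Let Dval (h Y : R) := (sg * Y - Dl * h) / Om.

(** The equations satisfied by the quadratic invariants of the planar rotation
    part, see [orbit_reduced]. To first order [h] is constant and [(P, Y)] turns
    with squared frequency [Om] on the cone given by the last equation. *)
Definition reduced_solution (h P Y w : R -> R) :=
  forall t : R,
  [/\ is_derive t (1 : R) h (2 * w t * P t),
      is_derive t (1 : R) P (- Y t - 2 * w t * Dval (h t) (Y t)),
      is_derive t (1 : R) Y (Om * P t + 2 * sg * w t * P t),
      is_derive t (1 : R) w (- d * w t + mu * Dval (h t) (Y t) + nu * P t)
    & Y t ^+ 2 + Om * P t ^+ 2 = Dl * h t ^+ 2].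

(** The condition [0 <= sg * h] holds for the quadratic forms of an actual orbit,
    where [h] is a definite form of the sign of [sg]; the constraint of
    [reduced_solution] alone does not exclude the opposite sign. *)
Definition no_small_orbit := exists2 eta : R, 0 < eta &
  forall (h P Y w : R -> R) (T : R), reduced_solution h P Y w ->
  0 < T -> (forall t, h (t + T) = h t) -> (forall t, P (t + T) = P t) ->
  (forall t, Y (t + T) = Y t) -> (forall t, w (t + T) = w t) ->
  (forall t, 0 <= sg * h t) -> (forall t, `|h t| <= eta) ->
  (forall t, `|w t| <= eta) -> forall t, h t = 0 /\ w t = 0.

(** Arguments of the error terms, independent of any orbit so that the constants
    are uniform; [st_Z] is the deviation of [w] from its approximate value on a
    center manifold. *)
Record state := State {st_h : R; st_P : R; st_Y : R; st_Z : R}.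

Definition cone : set state :=
  [set v | st_Y v ^+ 2 + Om * st_P v ^+ 2 = Dl * st_h v ^+ 2].

Definition st_D (v : state) : R := (sg * st_Y v - Dl * st_h v) / Om.
Definition size1 (v : state) : R := `|st_h v|.
Definition size2 (v : state) : R := `|st_h v| + `|st_Z v|.

Lemma order1_h : order_ge cone size1 1 st_h.
Proof. by exists 1 => // v _; rewrite mul1r expr1. Qed.

Lemma norm_le_sqr (a b C : R) : 0 <= C -> a ^+ 2 <= C ^+ 2 * b ^+ 2 ->
  `|a| <= C * `|b|.
Proof.
move=> C0 ab; rewrite -(ger0_norm C0) -normrM.
by rewrite -ler_sqr ?nnegrE // !real_normK ?num_real // exprMn.
Qed.

Lemma order1_P : order_ge cone size1 1 st_P.
Proof.
exists (Num.sqrt (Dl / Om)); first exact: sqrtr_ge0.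
move=> v co; rewrite expr1.
apply: norm_le_sqr; first exact: sqrtr_ge0.
rewrite sqr_sqrtr; last by rewrite divr_ge0 ?ltW.
rewrite mulrAC ler_pdivlMr //.
by rewrite -co mulrC lerDr sqr_ge0.
Qed.

Lemma order1_Y : order_ge cone size1 1 st_Y.
Proof.
exists (Num.sqrt Dl); first exact: sqrtr_ge0.
move=> v co; rewrite expr1.
apply: norm_le_sqr; first exact: sqrtr_ge0.
rewrite sqr_sqrtr ?(ltW Dl_gt0) // -co lerDl.
by rewrite mulr_ge0 ?sqr_ge0 ?(ltW Om_gt0).
Qed.

Lemma order1_D : order_ge cone size1 1 st_D.
Proof.
have [C C0 DC] : order_ge cone size1 1
    (fun v => Om^-1 * (sg * st_Y v + - (Dl * st_h v))).
  have := order1_h; have := order1_Y => *; order_ge_tac.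
by exists C => // v Av; rewrite /st_D mulrC; exact: DC.
Qed.

Lemma order_size12 f : order_ge cone size1 1 f -> order_ge cone size2 1 f.
Proof.
move=> [C C0 fC]; exists C => // v Av; rewrite (le_trans (fC v Av)) //.
by rewrite ler_wpM2l // !expr1 lerDl normr_ge0.
Qed.

Lemma order2_Z : order_ge cone size2 1 st_Z.
Proof. by exists 1 => // v _; rewrite mul1r expr1 lerDr normr_ge0. Qed.

(** [w] follows [a0 * h + a1 * P + a2 * Y], its response to the linear forcing;
    [Z] is the deviation from it. Then [h' = 2 * w * P] contains [2 * a1 * P ^ 2],
    whose mean over a turn is [a1 * Dl / Om * h ^ 2]: [a1] is the first Lyapunov
    coefficient. The mixed terms of [V] integrate the oscillating part of [h'],
    the square of [Z] absorbs the product [Z * P], and the factor [a1^-1] makes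
    the result nonnegative; the rest carries a factor [w] and is negligible. *)
Lemma reduced_lyapunov1 (a0 a1 a2 : R) :
  d * a0 = - (mu * Dl / Om) -> a2 * Om + d * a1 = nu ->
  - a1 + d * a2 = mu * sg / Om -> a1 != 0 ->
  no_small_orbit.
Proof.
move=> a0E a1E a2E a1_neq0.
have O0 : Om != 0 by rewrite gt_eqF.
pose B (v : state) :=
  - (4 * a0 / Om) * (st_P v * st_Y v) + - (4 * a0 * sg / Om) * (st_h v * st_P v)
  + - (4 * a2 * sg / Om) * (st_Y v * st_P v) + - (2 * a1 * sg / Om) * (st_P v * st_P v)
  + 2 * a1 / Om * (st_D v * st_Y v)
  + (4 / (a1 * d)) * (st_Z v * ((2 * a0 + 2 * sg * a2) * st_P v
                               + - (2 * a1) * st_D v)).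
have [C C0 BC] : order_ge cone size2 2 B.
  have := order_size12 order1_h; have := order_size12 order1_P.
  have := order_size12 order1_Y; have := order_size12 order1_D; have := order2_Z.
  move=> *; rewrite /B; order_ge_tac.
pose m := Num.min (Dl / (2 * Om)) (2 / a1 ^+ 2).
have m0 : 0 < m.
  rewrite lt_min; apply/andP; split; apply: divr_gt0 => //.
    exact: mulr_gt0.
  by rewrite exprn_even_gt0.
exists (m * `|a1| / (4 * (C + 1))).
  by rewrite divr_gt0 ?mulr_gt0 ?normr_gt0 // ltr_wpDl.
move=> h P Y w T sol T0 hT PT YT wT _ _ weta.
pose Z (s : R) : R := w s - (a0 * h s + a1 * P s + a2 * Y s).
pose V (s : R) : R := a1^-1 * (h s - 2 * a0 / Om * (h s * Y s) - a2 / Om * (Y s * Y s)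
  - a1 / Om * (P s * Y s) - 2 / (a1 * d) * (Z s * Z s)).
pose v t := State (h t) (P t) (Y t) (Z t).
pose dV (t : R) : R := a1^-1 * (2 * Z t * P t + a1 * Dl / Om * h t ^+ 2 + 4 / a1 * Z t ^+ 2
  + w t * B (v t)).
have wE t : w t = Z t + (a0 * h t + a1 * P t + a2 * Y t).
  by rewrite /Z; ring.
have Z' (t : R) : is_derive t (1 : R) Z (- d * Z t - w t *
    (2 * a0 * P t - 2 * a1 * Dval (h t) (Y t) + 2 * sg * a2 * P t)).
  have [h' P' Y' w' co] := sol t.
  rewrite /Z; derive_tac.
  have -> : mu * Dval (h t) (Y t) = d * a0 * h t + (- a1 + d * a2) * Y t.
    by rewrite a0E a2E /Dval; field.
  by rewrite -a1E; ring.
have V' (t : R) : is_derive t (1 : R) V (dV t).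
  have [h' P' Y' w' co] := sol t; have Zt' := Z' t.
  rewrite /V; derive_tac.
  rewrite /dV /B /v /= /st_D /Dval /=.
  have -> : a1 * Dl / Om * h t ^+ 2 = a1 / Om * (Y t ^+ 2 + Om * P t ^+ 2).
    by rewrite co; ring.
  by rewrite wE; field; rewrite O0 d_neq0.
have dV_ge t : m / 2 * (h t ^+ 2 + Z t ^+ 2) <= dV t.
  have [_ _ _ _ co] := sol t.
  have Bt : `|w t * B (v t) / a1| <= m / 2 * (h t ^+ 2 + Z t ^+ 2).
    rewrite !normrM normfV ler_pdivrMr ?normr_gt0 //.
    have e2t : size2 (v t) ^+ 2 <= 2 * (h t ^+ 2 + Z t ^+ 2).
      rewrite /size2 /= -[h t ^+ 2]real_normK ?num_real //.
      rewrite -[Z t ^+ 2]real_normK ?num_real //.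
      by have := sqr_ge0 (`|h t| - `|Z t|); rewrite -subr_ge0; nra.
    apply: (@le_trans _ _ (m * `|a1| / (4 * (C + 1)) *
        (C * (2 * (h t ^+ 2 + Z t ^+ 2))))).
      apply: ler_pM => //; apply: (le_trans (BC _ _)) => //.
      by rewrite ler_wpM2l.
    have -> : m * `|a1| / (4 * (C + 1)) * (C * (2 * (h t ^+ 2 + Z t ^+ 2)))
        = C / (C + 1) * (m / 2 * (h t ^+ 2 + Z t ^+ 2) * `|a1|).
      by field; rewrite gt_eqF // ltr_wpDl.
    rewrite ler_piMl ?mulr_ge0 ?addr_ge0 ?sqr_ge0 ?(ltW m0) //.
    by rewrite ler_pdivrMr ?ltr_wpDl // mul1r lerDl.
  have m1 : m * h t ^+ 2 <= Dl / (2 * Om) * h t ^+ 2.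
    by rewrite ler_wpM2r ?sqr_ge0 // ge_min lexx.
  have m2 : m * Z t ^+ 2 <= 2 / a1 ^+ 2 * Z t ^+ 2.
    by rewrite ler_wpM2r ?sqr_ge0 // ge_min lexx orbT.
  have -> : dV t = Dl / (2 * Om) * h t ^+ 2 + 2 / a1 ^+ 2 * Z t ^+ 2
      + (P t + 2 * Z t / a1) ^+ 2 / 2 + Y t ^+ 2 / (2 * Om) + w t * B (v t) / a1.
    rewrite /dV; have -> : a1 * Dl / Om * h t ^+ 2 = a1 * Dl / (2 * Om) * h t ^+ 2
        + a1 / (2 * Om) * (Y t ^+ 2 + Om * P t ^+ 2) by rewrite co; field.
    by field; rewrite a1_neq0.
  have := sqr_ge0 (P t + 2 * Z t / a1).
  have : 0 <= Y t ^+ 2 / (2 * Om) by rewrite divr_ge0 ?sqr_ge0 ?mulr_ge0 ?(ltW Om_gt0).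
  move: Bt; rewrite ler_norml => /andP[+ _].
  lra.
have VT t : V (t + T) = V t by rewrite /V /Z hT PT YT wT.
have dV0 := periodic_ge0_derive T0 VT V' _.
move=> t; have [_ _ _ _ co] := sol t.
have hZ0 : h t ^+ 2 + Z t ^+ 2 = 0.
  apply/eqP; rewrite eq_le addr_ge0 ?sqr_ge0 // andbT.
  rewrite -(pmulr_rle0 _ (divr_gt0 m0 (ltr0n R 2))) -(dV0 _ t) ?dV_ge //.
  move=> s; apply: le_trans (dV_ge s).
  by rewrite mulr_ge0 ?divr_ge0 ?(ltW m0) // addr_ge0 ?sqr_ge0.
move/eqP: hZ0; rewrite paddr_eq0 ?sqr_ge0 // !sqrf_eq0 => /andP[/eqP h0 /eqP Zt0].
split=> //; rewrite h0 expr0n /= mulr0 in co; move/eqP: co.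
have OP0 : 0 <= Om * P t ^+ 2 by rewrite mulr_ge0 ?sqr_ge0 ?(ltW Om_gt0).
rewrite paddr_eq0 ?sqr_ge0 // sqrf_eq0 mulf_eq0 sqrf_eq0 (negPf O0) /=.
move=> /andP[/eqP Y0 /eqP P0].
by rewrite wE h0 Zt0 Y0 P0 !mulr0 !addr0.
Qed.

(** The shape of the estimate at the second order: by [z * a ^ 2 * M <=
    (z ^ 2 + M ^ 2 * a ^ 4) / 2], small [a] and [z] make the error terms smaller
    than the main ones. *)
Lemma quartic_absorb (M s a z : R) : 0 <= M -> 0 < s -> 0 <= a -> 0 <= z ->
  (M ^+ 2 / 2 + M) * a <= s / 2 -> M * z <= 1 / 4 ->
  s / 2 * a ^+ 3 + z ^+ 2 / 4 <=
  s * a ^+ 3 + z ^+ 2 - M * (z * a ^+ 2 + z ^+ 3 + a ^+ 4).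
Proof.
move=> M0 s0 a0 z0 Ma Mz.
have a3 : (M ^+ 2 / 2 + M) * a ^+ 4 <= s / 2 * a ^+ 3.
  by rewrite [a ^+ 4]exprS mulrA ler_wpM2r ?exprn_ge0.
have z3 : M * z ^+ 3 <= 1 / 4 * z ^+ 2.
  by rewrite [z ^+ 3]exprS mulrA ler_wpM2r ?exprn_ge0.
have := sqr_ge0 (z - M * a ^+ 2); nra.
Qed.

(** When the first Lyapunov coefficient vanishes, the response of [w] is
    [kap * D] with [D] the value of [Dval], and its deviation [Z] is of second
    order. Adding [Z * A] to [h] removes the product of [Z] with linear terms;
    among the remaining cubic terms, [- 2 * kap ^ 2 * D * P * A] has the mean
    [l * h ^ 3], where [l] is the second Lyapunov coefficient: it has the sign of
    [d] and never vanishes. The other terms of [V] integrate the oscillating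
    parts, and [Z * Z] makes [V'] definite in [Z] as well. *)
Lemma reduced_lyapunov2 (kap : R) :
  kap != 0 -> mu = kap * d -> nu = kap * sg ->
  no_small_orbit.
Proof.
move=> kap_neq0 muE nuE.
have O0 : Om != 0 by rewrite gt_eqF.
have sg_neq0 : sg != 0.
  rewrite -sqrf_eq0 gt_eqF // (_ : sg ^+ 2 = Om + Dl) ?addr_gt0 //.
  by rewrite Om_def subrK.
have Od_gt0 : 0 < Om + d ^+ 2 by rewrite ltr_wpDr ?sqr_ge0.
have Od0 : Om + d ^+ 2 != 0 by rewrite gt_eqF.
(* [al1] and [al2] solve [A' - d * A = - 2 * P] for the linear flow. *)
pose al2 := - 2 / (Om + d ^+ 2); pose al1 := - d * al2.
have al1_neq0 : al1 != 0.
  rewrite /al1 /al2 mulf_eq0 oppr_eq0 (negPf d_neq0) /=.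
  by rewrite mulf_eq0 invr_eq0 (negPf Od0) orbF oppr_eq0 pnatr_eq0.
(* [K], the coefficient of [Z ^ 2] in the derivative, has the sign of [l * h ^ 3]. *)
pose l := kap ^+ 2 * al1 * Dl ^+ 2 / Om ^+ 2.
pose K := l * sg.
have K_neq0 : K != 0.
  have Dl0 : Dl != 0 by rewrite gt_eqF.
  by rewrite /K /l; do !apply: mulf_neq0 => //; rewrite ?invr_eq0 expf_neq0.
pose wc (v : state) : R := st_Z v + kap * st_D v.
pose B2 (v : state) : R :=
  - (2 * kap) * (st_P v * (al1 * st_P v + al2 * st_Y v))
  + - (4 * kap / sg) * (st_D v * st_P v)
  + wc v * (- (2 * al1) * st_D v + 2 * sg * al2 * st_P v)
  + 2 * K * kap / d * (wc v * st_P v).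
pose C3 (v : state) : R :=
  8 * kap ^+ 2 / sg ^+ 2 * (st_D v * (st_D v * st_P v))
  + 4 * kap ^+ 2 * al1 * sg / Om * (st_D v * (st_P v * st_P v))
  + kap ^+ 2 * al1 * Dl / Om ^+ 2 * (- 2 * (st_P v * (st_P v * st_Y v))
    + - (2 * sg) * (st_h v * (st_P v * st_P v))
    + 2 * (st_h v * (st_D v * st_Y v)))
  + 2 * kap ^+ 2 * al2 / sg ^+ 2 * (2 * Om * (st_D v * (st_D v * st_P v))
    + Dl * (st_P v * (st_D v * st_D v)) + 2 * Dl * (st_h v * (st_D v * st_P v))).
have [b b0 B2b] : order_ge cone size2 2 B2.
  have := order_size12 order1_h; have := order_size12 order1_P.
  have := order_size12 order1_Y; have := order_size12 order1_D; have := order2_Z.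
  move=> Zo *; rewrite /B2 /wc; order_ge_tac.
have [c c0 C3c] : order_ge cone size1 3 C3.
  have := order1_h; have := order1_P; have := order1_Y; have := order1_D.
  by move=> *; rewrite /C3; order_ge_tac.
have [g g0 Dg] : order_ge cone size1 1 (fun v => kap * st_D v).
  by have := order1_D => *; order_ge_tac.
pose M := (2 * (b + c) + c * g) / `|K|.
have M0 : 0 <= M by rewrite divr_ge0 // addr_ge0 ?mulr_ge0 ?addr_ge0.
pose e := Num.min 1 (Num.min ((4 * (M + 1) * (1 + g))^-1)
  ((2 * `|sg| * (M ^+ 2 / 2 + M + 1))^-1)).
have Mp : 0 < M ^+ 2 / 2 + M + 1.
  by rewrite ltr_wpDl // addr_ge0 // divr_ge0 ?sqr_ge0.
have M1p : 0 < M + 1 by rewrite ltr_wpDl.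
have gp : 0 < 1 + g by rewrite ltr_wpDr.
have sgp : 0 < `|sg| by rewrite normr_gt0.
have ep : 0 < e.
  rewrite lt_min ltr01 lt_min !invr_gt0 /=; apply/andP; split.
    by rewrite !mulr_gt0.
  by rewrite !mulr_gt0.
exists e => // h P Y w T sol T0 hT PT YT wT hsg he we.
have e1 : e <= 1 by rewrite ge_min lexx.
have eM : e * (4 * (M + 1) * (1 + g)) <= 1.
  rewrite -ler_pdivlMr ?mulr_gt0 // mul1r.
  by rewrite ge_min ge_min lexx orbT.
have eS : e * (2 * `|sg| * (M ^+ 2 / 2 + M + 1)) <= 1.
  rewrite -ler_pdivlMr ?mulr_gt0 // mul1r.
  by rewrite ge_min ge_min lexx !orbT.
pose D s := Dval (h s) (Y s).
pose Z (s : R) : R := w s - kap * D s.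
pose A (s : R) : R := al1 * P s + al2 * Y s.
pose V (s : R) : R := K^-1 * (h s + Z s * A s - kap / sg * (D s * D s)
  + 4 * kap ^+ 2 / (3 * sg ^+ 2) * (D s * (D s * D s))
  - 2 * kap ^+ 2 * al1 * sg / (3 * Om) * (P s * (P s * P s))
  - kap ^+ 2 * al1 * Dl / Om ^+ 2 * (h s * (P s * Y s))
  + 2 * kap ^+ 2 * al2 * Om / (3 * sg ^+ 2) * (D s * (D s * D s))
  + kap ^+ 2 * al2 * Dl / sg ^+ 2 * (h s * (D s * D s))
  - K / (2 * d) * (Z s * Z s)).
pose v t := State (h t) (P t) (Y t) (Z t).
pose dV (t : R) : R := K^-1 * (l * h t ^+ 3 + K * Z t ^+ 2
  + (Z t * B2 (v t) + w t * C3 (v t))).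
have wE t : w t = Z t + kap * D t by rewrite /Z; ring.
have D' (t : R) : is_derive t (1 : R) D ((sg + 2 * w t) * P t).
  have [h' P' Y' w' co] := sol t.
  by rewrite /D /Dval; derive_tac; rewrite Om_def; field; rewrite -Om_def.
have Z' (t : R) : is_derive t (1 : R) Z (- d * Z t - 2 * kap * w t * P t).
  have [h' P' Y' w' co] := sol t; have Dt' := D' t.
  by rewrite /Z; derive_tac; rewrite -/(D t) muE nuE; ring.
have V' (t : R) : is_derive t (1 : R) V (dV t).
  have [h' P' Y' w' co] := sol t; have Dt' := D' t; have Zt' := Z' t.
  rewrite /V /A; derive_tac; rewrite -/(D t).
  have lE : l * h t ^+ 3 = kap ^+ 2 * al1 * Dl / Om ^+ 2 * h t
      * (Y t ^+ 2 + Om * P t ^+ 2) by rewrite co /l; field.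
  have YE : Y t = (Om * D t + Dl * h t) / sg.
    by rewrite /D /Dval; field; rewrite sg_neq0.
  have DlE : Dl = sg ^+ 2 - Om by rewrite Om_def; ring.
  rewrite /dV lE /B2 /C3 /wc /v /= -/(D t) /st_D /= -/(Dval (h t) (Y t)) -/(D t).
  rewrite -wE; congr (K^-1 * _).
  rewrite wE YE DlE /al1 /al2; move: (D t) (h t) (P t) (Z t) => D0 h0 P0 Z0.
  clearbody K.
  by field; rewrite sg_neq0 Od0 O0 d_neq0.
have dV_ge t : `|sg|^-1 / 2 * `|h t| ^+ 3 + `|Z t| ^+ 2 / 4 <= dV t.
  have [_ _ _ _ co] := sol t.
  have Dt : `|kap * D t| <= g * `|h t| by have := Dg (v t) co; rewrite expr1.
  have a0 := normr_ge0 (h t); have z0 := normr_ge0 (Z t).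
  set a := `|h t| in Dt a0 *; set z := `|Z t| in z0 *.
  have wz : `|w t| <= z + g * a.
    by rewrite wE (le_trans (ler_normD _ _)) // lerD2l.
  have a1 : a <= e := he t.
  have ze : z <= e * (1 + g).
    have -> : z = `|w t - kap * D t| by rewrite wE addrK.
    rewrite (le_trans (ler_normB _ _)) // mulrDr mulr1 lerD //.
    by rewrite (le_trans Dt) // mulrC ler_wpM2r.
  have rem : `|K^-1 * (Z t * B2 (v t) + w t * C3 (v t))| <=
      M * (z * a ^+ 2 + z ^+ 3 + a ^+ 4).
    rewrite normrM normfV /M mulrC -mulrA [_^-1 * _]mulrC mulrA.
    rewrite ler_pM2r ?invr_gt0 ?normr_gt0 //.
    apply: le_trans (ler_normD _ _) _; rewrite !normrM -/z.
    have B2t : `|B2 (v t)| <= b * (a + z) ^+ 2 := B2b (v t) co.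
    have C3t : `|C3 (v t)| <= c * a ^+ 3 := C3c (v t) co.
    have zB : z * `|B2 (v t)| <= z * (b * (2 * (a ^+ 2 + z ^+ 2))).
      rewrite ler_wpM2l // (le_trans B2t) // ler_wpM2l //.
      by have := sqr_ge0 (a - z); nra.
    have wC : `|w t| * `|C3 (v t)| <= (z + g * a) * (c * a ^+ 3).
      by rewrite ler_pM.
    have za : z * a ^+ 3 <= z * a ^+ 2.
      by rewrite ler_wpM2l // ler_wiXn2l // (le_trans a1).
    have c1 : c * (z * a ^+ 3) <= c * (z * a ^+ 2) by rewrite ler_wpM2l.
    have p1 : 0 <= c * (z * a ^+ 2) by rewrite !mulr_ge0 ?exprn_ge0.
    have p2 : 0 <= c * z ^+ 3 by rewrite !mulr_ge0 ?exprn_ge0.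
    have p3 : 0 <= b * a ^+ 4 by rewrite !mulr_ge0 ?exprn_ge0.
    have p4 : 0 <= c * a ^+ 4 by rewrite !mulr_ge0 ?exprn_ge0.
    have p5 : 0 <= c * g * (z * a ^+ 2) by rewrite !mulr_ge0 ?exprn_ge0.
    have p6 : 0 <= c * g * z ^+ 3 by rewrite !mulr_ge0 ?exprn_ge0.
    apply: le_trans (lerD zB wC) _; lra.
  have ah : h t ^+ 3 / sg = `|sg|^-1 * a ^+ 3.
    rewrite /a; move: (hsg t); have [sg0|sg0|sg0] := ltgtP sg 0.
    - by rewrite nmulr_rge0 // => h0; rewrite (ler0_norm h0) (ltr0_norm sg0); field.
    - by rewrite pmulr_rge0 // => h0; rewrite (ger0_norm h0) (gtr0_norm sg0); field.
    - by move/eqP: sg0; rewrite (negPf sg_neq0).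
  have -> : dV t = `|sg|^-1 * a ^+ 3 + z ^+ 2
      + K^-1 * (Z t * B2 (v t) + w t * C3 (v t)).
    rewrite /dV -ah /z real_normK ?num_real // mulrDr; congr (_ + _).
    have l0 : l != 0 by move: K_neq0; rewrite /K mulf_eq0 => /norP[].
    by rewrite /K; field; rewrite sg_neq0.
  have := @quartic_absorb M (`|sg|^-1) a z M0 _ a0 z0 _ _.
  rewrite invr_gt0 sgp => /(_ isT) qa.
  have Ma : (M ^+ 2 / 2 + M) * a <= `|sg|^-1 / 2.
    rewrite -[_ / 2]mul1r -ler_pdivrMr ?divr_gt0 ?invr_gt0 //.
    apply: le_trans eS; rewrite invfM invrK invrK.
    have : (M ^+ 2 / 2 + M) * a <= e * (M ^+ 2 / 2 + M + 1).
      rewrite mulrC ler_pM // ?lerDl //.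
      by rewrite addr_ge0 // divr_ge0 ?sqr_ge0.
    rewrite -(ler_pM2r sgp); nra.
  have Mz : M * z <= 1 / 4.
    have : M * z <= M * (e * (1 + g)) by rewrite ler_wpM2l.
    have : 0 <= e * (1 + g) by rewrite mulr_ge0 ?ltW.
    lra.
  move: rem; rewrite ler_norml => /andP[+ _].
  have := qa Ma Mz; lra.
have VT t : V (t + T) = V t by rewrite /V /A /Z /D hT PT YT wT.
have dV_ge0 t : 0 <= dV t.
  by apply: le_trans (dV_ge t); rewrite addr_ge0 ?mulr_ge0 ?invr_ge0 ?exprn_ge0.
have dV0 := periodic_ge0_derive T0 VT V' dV_ge0.
move=> t; have [_ _ _ _ co] := sol t.
have h3 : 0 <= `|sg|^-1 / 2 * `|h t| ^+ 3.
  by rewrite mulr_ge0 ?divr_ge0 ?invr_ge0 ?exprn_ge0.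
have Z2 : 0 <= `|Z t| ^+ 2 / 4 by rewrite mulr_ge0 ?exprn_ge0.
have : `|sg|^-1 / 2 * `|h t| ^+ 3 + `|Z t| ^+ 2 / 4 == 0.
  by rewrite eq_le addr_ge0 // andbT -(dV0 t).
rewrite paddr_eq0 // => /andP[]; rewrite mulf_eq0 gt_eqF ?divr_gt0 ?invr_gt0 //=.
rewrite expf_eq0 normr_eq0 /= => /eqP h0.
rewrite mulf_eq0 invr_eq0 pnatr_eq0 orbF expf_eq0 normr_eq0 /= => /eqP Zt0.
split=> //; rewrite h0 expr0n /= mulr0 in co; move/eqP: co.
have OP0 : 0 <= Om * P t ^+ 2 by rewrite mulr_ge0 ?sqr_ge0 ?(ltW Om_gt0).
rewrite paddr_eq0 ?sqr_ge0 // sqrf_eq0 mulf_eq0 sqrf_eq0 (negPf O0) /=.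
move=> /andP[/eqP Y0 _].
by rewrite wE Zt0 /D /Dval h0 Y0 !mulr0 subrr mul0r mulr0 addr0.
Qed.
End ReducedSystem.

(** * The linear part at the singular point *)

Section Jacobian.
Variable R : realType.
Implicit Types (a b c d : R) (p v : 'rV[R]_3).

Lemma der_coord p v i : is_derive p v (fun q : 'rV[R]_3 => q 0 i) (v 0 i).
Proof.
apply: DeriveDef; first exact/diff_derivable/differentiable_coord.
have := derive_mx (@derivable_id R _ p v).
by rewrite derive_id => /matrixP /(_ 0 i); rewrite mxE => ->.
Qed.

Lemma vfield_sum a b c d :
  vfield a b c d = fun q =>
    (a * (q 0 1 - q 0 0) + q 0 1 * q 0 2) *: (delta_mx 0 0 : 'rV[R]_3) +
    (b * q 0 0 + c * q 0 1 - q 0 0 * q 0 2) *: (delta_mx 0 1 : 'rV[R]_3) +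
    (- d * q 0 2 + q 0 0 * q 0 1 + 1) *: (delta_mx 0 2 : 'rV[R]_3).
Proof.
apply/funext => q; apply/rowP => -[[|[|[|//]]] j3]; rewrite !mxE /=;
  by rewrite ?mulr1 ?mulr0 ?addr0 ?add0r.
Qed.

Lemma differentiable_vfield a b c d p : differentiable (vfield a b c d) p.
Proof.
have cf i : differentiable (fun q : 'rV[R]_3 => q 0 i) p.
  exact: differentiable_coord.
rewrite vfield_sum; do !apply: differentiableD; apply: differentiableZl;
  do !(apply: differentiableD || apply: differentiableN || apply: differentiableM
       || exact: cf || exact: differentiable_cst).
Qed.

Lemma derive_vfield a b c d p v :
  'D_v (vfield a b c d) p = \row_(j < 3)
    [:: - a * v 0 0 + (a + p 0 2) * v 0 1 + p 0 1 * v 0 2;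
        (b - p 0 2) * v 0 0 + c * v 0 1 - p 0 0 * v 0 2;
        p 0 1 * v 0 0 + p 0 0 * v 0 1 - d * v 0 2]`_j.
Proof.
rewrite derive_mx; last exact/diff_derivable/differentiable_vfield.
have cf := der_coord p v; have cf0 := cf 0; have cf1 := cf 1; have cf2 := cf 2.
apply/rowP => j; rewrite !mxE; apply: derive_val.
case: j => -[|[|[|//]]] j3 /=.
- rewrite (_ : (fun q => vfield a b c d q 0 (Ordinal j3)) =
    fun q : 'rV[R]_3 => a * (q 0 1 - q 0 0) + q 0 1 * q 0 2); last first.
    by apply/funext => q; rewrite mxE.
  by derive_tac; ring.
- rewrite (_ : (fun q => vfield a b c d q 0 (Ordinal j3)) =
    fun q : 'rV[R]_3 => b * q 0 0 + c * q 0 1 - q 0 0 * q 0 2); last first.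
    by apply/funext => q; rewrite mxE.
  by derive_tac; ring.
- rewrite (_ : (fun q => vfield a b c d q 0 (Ordinal j3)) =
    fun q : 'rV[R]_3 => - d * q 0 2 + q 0 0 * q 0 1 + 1); last first.
    by apply/funext => q; rewrite mxE.
  by derive_tac; ring.
Qed.

Lemma mul_cjacobian_E1 a b c d (v : 'rV[R[i]]_3) :
  v *m cjacobian (vfield a b c d) (E1 d) = \row_(j < 3)
    [:: (- a)%:C%C * v 0 0 + (a + 1 / d)%:C%C * v 0 1;
        (b - 1 / d)%:C%C * v 0 0 + c%:C%C * v 0 1;
        (- d)%:C%C * v 0 2]`_j.
Proof.
have J i : row i (jacobian (vfield a b c d) (E1 d)) = \row_(j < 3)
    [:: [:: - a; a + 1 / d; 0]`_i; [:: b - 1 / d; c; 0]`_i;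
        [:: 0; 0; - d]`_i]`_j.
  rewrite rowE -deriveEjacobian; last exact: differentiable_vfield.
  rewrite derive_vfield; apply/rowP => j; rewrite !mxE /=.
  by case: i => -[|[|[|//]]] i3; case: j => -[|[|[|//]]] j3 /=; rewrite ?mxE /=; ring.
apply/rowP => j; rewrite !mxE !big_ord_recl big_ord0 /=.
have Jij i k : cjacobian (vfield a b c d) (E1 d) i k =
    ((row i (jacobian (vfield a b c d) (E1 d))) 0 k)%:C%C.
  by rewrite !mxE.
rewrite !Jij !J !mxE /=.
have -> : lift ord0 ord0 = 1 :> 'I_3 by exact/val_inj.
have -> : lift ord0 (lift ord0 ord0) = 2 :> 'I_3 by exact/val_inj.
by case: j => -[|[|[|//]]] j3 /=; rewrite ?rmorph0; ring.
Qed.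

Lemma complexP (z z' : R[i]) : complex.Re z = complex.Re z' ->
  complex.Im z = complex.Im z' -> z = z'.
Proof. by case: z z' => [? ?] [? ?] /= -> ->. Qed.

(** An eigenvector of the linear part for the eigenvalue [i * w]. *)
Definition hopf_vector c d w : 'rV[R[i]]_3 :=
  \row_(j < 3) [:: (c + 1 / d)%:C%C; Complex c w; 0]`_j.

Lemma hopf_vector_eigen b c d w :
  w ^+ 2 = - (c ^+ 2 + (c + 1 / d) * (b - 1 / d)) ->
  hopf_vector c d w *m cjacobian (vfield c b c d) (E1 d)
  = Complex 0 w *: hopf_vector c d w.
Proof.
move=> w2; rewrite mul_cjacobian_E1; apply/rowP => j; rewrite !mxE /=.
case: j => -[|[|[|//]]] j3; apply: complexP => /=; try ring.
by rewrite [w * w]w2; ring.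
Qed.

Section Hopf.
Variables b c d : R.
Hypothesis d_neq0 : d != 0.
Hypothesis disc : 0 < (1 + c * d) * (1 - b * d) - c ^+ 2 * d ^+ 2.

Let w := Num.sqrt ((1 + c * d) * (1 - b * d) - c ^+ 2 * d ^+ 2) / d.

Lemma hopf_frequency :
  w != 0 /\ w ^+ 2 = - (c ^+ 2 + (c + 1 / d) * (b - 1 / d)).
Proof.
split; first by rewrite mulf_neq0 ?invr_eq0 // gt_eqF ?sqrtr_gt0.
by rewrite /w exprMn sqr_sqrtr ?(ltW disc) //; field.
Qed.

Lemma hopf_point_E1 : hopf_point (vfield c b c d) (E1 d).
Proof.
have [w0 w2] := hopf_frequency.
split.
  by apply/rowP => -[[|[|[|//]]] j3]; rewrite !mxE /=; field.
exists w, (- d).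
have eig u : u != 0 -> u ^+ 2 = w ^+ 2 ->
    eigenvalue (cjacobian (vfield c b c d) (E1 d)) (Complex 0 u).
  move=> u0 u2; apply/eigenvalueP; exists (hopf_vector c d u).
    by apply: hopf_vector_eigen; rewrite u2.
  apply/eqP => /rowP /(_ 1); rewrite !mxE /= => -[_ u00].
  by rewrite u00 eqxx in u0.
split=> //; rewrite ?oppr_eq0 //.
- exact: eig.
- by apply: eig; rewrite ?oppr_eq0 ?sqrrN.
apply/eigenvalueP; exists (delta_mx 0 2).
  rewrite mul_cjacobian_E1; apply/rowP => j; rewrite !mxE /=.
  by case: j => -[|[|[|//]]] j3 /=; rewrite ?mulr0 ?mulr1 ?addr0.
by apply/eqP => /rowP /(_ 2); rewrite !mxE /= => /eqP; rewrite oner_eq0.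
Qed.

Lemma center_plane_E1 (u : 'rV[R]_3) : u 0 2 = 0 ->
  center_plane (vfield c b c d) (E1 d) u.
Proof.
have [w0 w2] := hopf_frequency.
have m0 : c + 1 / d != 0.
  apply/eqP => m0; rewrite m0 mul0r addr0 in w2.
  have : 0 < w ^+ 2 by rewrite exprn_even_gt0.
  by rewrite w2 oppr_gt0 ltNge sqr_ge0.
move=> u2; exists w, (hopf_vector c d w), (u 0 0 / (c + 1 / d)),
  ((u 0 1 - c * (u 0 0 / (c + 1 / d))) / w); split=> //.
  exact: hopf_vector_eigen.
apply/rowP => j; rewrite !mxE /=.
case: j => -[|[|[|//]]] j3 /=.
- rewrite mulr0 addr0 divfK //; congr (u 0 _); exact/val_inj.
- rewrite divfK // [_ * c]mulrC addrC subrK; congr (u 0 _); exact/val_inj.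
- by rewrite !mulr0 addr0 -u2; congr (u 0 _); exact/val_inj.
Qed.
End Hopf.
End Jacobian.

(** * A center forces b = c = 0 *)

Section Orbits.
Variables (R : realType).
Implicit Types (a b c d : R) (g : R -> 'rV[R]_3) (W : set 'rV[R]_3).

Lemma solution_coords b c d g t : d != 0 ->
  solution_on (vfield c b c d) setT g ->
  let x s := g s 0 0 in let y s := g s 0 1 in let w s := g s 0 2 - 1 / d in
  [/\ is_derive t (1 : R) x (- c * x t + (c + 1 / d) * y t + y t * w t),
      is_derive t (1 : R) y ((b - 1 / d) * x t + c * y t - x t * w t)
    & is_derive t (1 : R) w (- d * w t + x t * y t)].
Proof.
move=> d0 sol /=; have g' j := is_derive_coord 0 j (sol t I).
have g0 := g' 0; have g1 := g' 1; have g2 := g' 2; rewrite !mxE /= in g0 g1 g2.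
by split; derive_tac; field.
Qed.

Lemma nbhs_box (p : 'rV[R]_3) r : 0 < r ->
  nbhs p [set q : 'rV[R]_3 | forall j, `|q 0 j - p 0 j| < r].
Proof.
move=> r0; have := nbhsx_ballx p r r0; apply: filterS => q.
rewrite mx_norm_ball /ball_ /= /Num.Def.normr /= mx_normrE => pq j.
have := le_lt_trans (le_bigmax _ (fun i : 'I_1 * 'I_3 => `|(p - q) i.1 i.2|) (0, j)) pq.
by rewrite /= !mxE distrC.
Qed.

Lemma tangent_accumulation W p V (v : 'rV[R]_3) :
  tangent_space W p v -> v != 0 -> nbhs p V ->
  exists q, [/\ W q, V q & q <> p].
Proof.
move=> [g [g0 Wg gv]] v0 pV; apply: contrapT => nq.
have gc : {for 0, continuous g}.
  apply: differentiable_continuous; apply/derivable1_diffP.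
  exact: @ex_derive.
have Vg : \forall t \near (0 : R), V (g t) by apply: gc; rewrite g0.
have gp : \forall t \near (0 : R), cst p t = g t.
  apply: filterS2 Wg Vg => t Wt Vt; apply: contrapT => gtp.
  by apply: nq; exists (g t); split=> // /esym.
have pd := near_eq_is_derive gp (is_derive_cst p (0 : R) (1 : R)).
by move: v0; rewrite -(@derive_val _ _ _ _ _ _ _ gv) (@derive_val _ _ _ _ _ _ _ pd) eqxx.
Qed.

Lemma center_orbit b c d W N : d != 0 ->
  0 < (1 + c * d) * (1 - b * d) - c ^+ 2 * d ^+ 2 ->
  tangent_space W (E1 d) = center_plane (vfield c b c d) (E1 d) ->
  center_on (vfield c b c d) (E1 d) W -> nbhs (E1 d) N ->
  forall V, nbhs (E1 d) V ->
  exists (g : R -> 'rV[R]_3) T, [/\ solution_on (vfield c b c d) setT g,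
    least_period g T, W (g 0) /\ V (g 0), g 0 <> E1 d & forall t, N (g t)].
Proof.
move=> d0 disc tW cW pN V pV; have [V' [pV' cV']] := cW N pN.
pose u : 'rV[R]_3 := delta_mx 0 0.
have u0 : u != 0.
  by apply/eqP => /rowP /(_ 0); rewrite !mxE /= => /eqP; rewrite oner_eq0.
have tu : tangent_space W (E1 d) u.
  by rewrite tW; apply: center_plane_E1; rewrite // mxE.
have [q [Wq [Vq V'q] qp]] := tangent_accumulation tu u0 (filterI pV pV').
have [g [T [sol g0 gT [K [_ KN gK _ _]]]]] := cV' q Wq V'q qp.
exists g, T; split; rewrite ?g0 // => t.
by have /KN[] := gK (g t) (ex_intro2 _ _ t I erefl).
Qed.

Section Forward.
Variables (b c d : R).
Hypothesis d_neq0 : d != 0.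
Hypothesis disc : 0 < (1 + c * d) * (1 - b * d) - c ^+ 2 * d ^+ 2.

Let k := b + c.
Let sg := 2 / d + c - b.
Let Dl := k ^+ 2 + 4 * c ^+ 2.
Let Om := sg ^+ 2 - Dl.

Lemma Om_gt0 : 0 < Om.
Proof.
have -> : Om = 4 * ((1 + c * d) * (1 - b * d) - c ^+ 2 * d ^+ 2) / d ^+ 2.
  by rewrite /Om /sg /Dl /k; field.
by apply: divr_gt0; [exact: mulr_gt0 | rewrite exprn_even_gt0].
Qed.

(** With [S] half the square of the distance to the axis, [P] is the derivative
    of [- S]: the quadratic terms of the system only rotate the plane. [h] is
    twice the Hamiltonian of the linear planar part, [D = h - sg * S] and
    [P] span the trace-free quadratic forms, and the forcing [x * y] is a
    combination of both. *)
Lemma orbit_reduced g : Dl != 0 -> solution_on (vfield c b c d) setT g ->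
  let x s := g s 0 0 in let y s := g s 0 1 in let w s := g s 0 2 - 1 / d in
  let D s := - (k / 2) * (x s * x s - y s * y s) - 2 * c * (x s * y s) in
  let S s := (x s * x s + y s * y s) / 2 in
  reduced_solution d sg Dl Om (- (2 * c / Dl)) (- (k / Dl))
    (fun s => D s + sg * S s)
    (fun s => c * (x s * x s - y s * y s) - k * (x s * y s))
    (fun s => sg * D s + Dl * S s) w.
Proof.
move=> Dl0 sol x y w D S t.
have Om0 : Om != 0 by rewrite gt_eqF // Om_gt0.
have [x' y' w'] := solution_coords t d_neq0 sol.
have DE : (sg * (sg * D t + Dl * S t) - Dl * (D t + sg * S t)) / Om = D t.
  by rewrite /Om; field; rewrite -/Om.
rewrite DE; split.
- rewrite /D /S; derive_tac; rewrite -/(x t) -/(y t) -/(w t) /sg /k; field.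
  exact: d_neq0.
- derive_tac; rewrite -/(x t) -/(y t) -/(w t) /D /S /Dl /sg /k; field.
  exact: d_neq0.
- rewrite /D /S; derive_tac; rewrite -/(x t) -/(y t) -/(w t) /Om /Dl /sg /k.
  field; exact: d_neq0.
- apply: der_eq w' _; rewrite -/(x t) -/(y t) -/(w t).
  have E : 2 * c * D t + k * (c * (x t * x t - y t * y t) - k * (x t * y t))
      = - (x t * y t) * Dl by rewrite /D /Dl /k; field.
  rewrite -addrA; congr (_ + _).
  apply: (mulIf Dl0); rewrite -[LHS]opprK -mulNr -E.
  by field.
- by rewrite /D /S /Om /Dl /k; field.
Qed.

(** A center provides periodic orbits in every neighborhood of [E1], whereas one
    of the two Lyapunov functions excludes them unless [Dl = 0]. *)
Lemma center_forces_bc0 W :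
  tangent_space W (E1 d) = center_plane (vfield c b c d) (E1 d) ->
  center_on (vfield c b c d) (E1 d) W -> b = 0 /\ c = 0.
Proof.
have k2 := sqr_ge0 k.
have c2 : 0 <= 4 * c ^+ 2 by rewrite mulr_ge0 ?sqr_ge0.
move=> tW cW; have [Dl_eq0|Dl0] := eqVneq Dl 0.
  move/eqP: Dl_eq0; rewrite paddr_eq0 // sqrf_eq0 mulf_eq0 pnatr_eq0.
  rewrite sqrf_eq0 /= => /andP[k0 /eqP c0].
  by move: k0; rewrite /k c0 addr0 => /eqP.
exfalso.
have Dl_gt0 : 0 < Dl by rewrite lt_def Dl0 addr_ge0.
have Om0 : Om != 0 by rewrite gt_eqF // Om_gt0.
pose mu := - (2 * c / Dl); pose nu := - (k / Dl).
pose hq (x y : R) := - (k / 2) * (x * x - y * y) - 2 * c * (x * y)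
  + sg * ((x * x + y * y) / 2).
have [eta eta0 noorbit] : no_small_orbit d sg Dl Om mu nu.
  have Od0 : Om + d ^+ 2 != 0 by rewrite gt_eqF // ltr_wpDr ?sqr_ge0 ?Om_gt0.
  have [l0|l0] := eqVneq (nu * d - mu * sg) 0.
    apply: (@reduced_lyapunov2 R d sg Dl Om mu nu d_neq0 Dl_gt0 Om_gt0 erefl (mu / d)).
    - apply/eqP => kap0; have mu0 : mu = 0 by rewrite -[mu](divfK d_neq0) kap0 mul0r.
      move: l0; rewrite mu0 mul0r subr0 => /eqP; rewrite mulf_eq0 (negPf d_neq0) orbF.
      move: mu0 => /eqP; rewrite /mu /nu !oppr_eq0 !mulf_eq0 !invr_eq0 (negPf Dl0) !orbF.
      rewrite pnatr_eq0 /= => /eqP c0 /eqP k0.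
      by move: Dl0; rewrite /Dl k0 c0 expr0n /= mulr0 addr0 eqxx.
    - by rewrite divfK.
    - by apply: (mulIf d_neq0); rewrite mulrAC divfK //; apply/eqP; rewrite -subr_eq0 l0.
  (* The solution of the linear system for [a0], [a1], [a2]. *)
  pose a1 := (nu * d - mu * sg) / (Om + d ^+ 2).
  have a10 : a1 != 0 by rewrite mulf_neq0 ?invr_eq0.
  apply: (@reduced_lyapunov1 R d sg Dl Om mu nu d_neq0 Dl_gt0 Om_gt0
    (- (mu * Dl / (Om * d))) a1 ((mu * sg / Om + a1) / d)) => //.
  - by field; rewrite d_neq0 Om0.
  - by rewrite /a1; field; rewrite d_neq0 Od0 Om0.
  - by field; rewrite d_neq0 Om0.
pose M := `|k| + 2 * `|c| + `|sg|.
have M0 : 0 <= M by rewrite !addr_ge0 ?mulr_ge0.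
pose r := Num.min 1 (eta / (M + 1)).
have r0 : 0 < r by rewrite lt_min ltr01 divr_gt0 // ltr_wpDl.
have [g [T [sol [T0 gT _] _ g0 gN]]] :=
  center_orbit d_neq0 disc tW cW (nbhs_box _ r0) (@filterT _ _ _).
have sg2 : Dl < sg ^+ 2 by rewrite -subr_gt0 Om_gt0.
have hsg x y : 0 <= sg * hq x y /\ (hq x y = 0 -> x = 0 /\ y = 0).
  pose D := - (k / 2) * (x * x - y * y) - 2 * c * (x * y).
  pose S := (x * x + y * y) / 2.
  have S0 : 0 <= S by rewrite divr_ge0 // addr_ge0 // -expr2 sqr_ge0.
  have DS : D ^+ 2 <= Dl * S ^+ 2.
    rewrite -subr_ge0.
    have -> : Dl * S ^+ 2 - D ^+ 2 = (c * (x * x - y * y) - k * (x * y)) ^+ 2.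
      by rewrite /Dl /D /S; field.
    exact: sqr_ge0.
  have -> : hq x y = D + sg * S by [].
  split.
    have : `|sg * D| <= sg ^+ 2 * S.
      have sS : 0 <= sg ^+ 2 * S by rewrite mulr_ge0 // sqr_ge0.
      rewrite -[leRHS]ger0_norm // -ler_sqr ?nnegrE //.
      rewrite !real_normK ?num_real //.
      have -> : (sg * D) ^+ 2 = sg ^+ 2 * D ^+ 2 by ring.
      have -> : (sg ^+ 2 * S) ^+ 2 = sg ^+ 2 * (sg ^+ 2 * S ^+ 2) by ring.
      rewrite ler_wpM2l ?sqr_ge0 // (le_trans DS) // ler_wpM2r ?sqr_ge0 //.
      exact: ltW.
    by rewrite ler_norml => /andP[+ _]; lra.
  move=> h0; have : (sg ^+ 2 - Dl) * S ^+ 2 <= 0.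
    have -> : (sg ^+ 2 - Dl) * S ^+ 2 = (D + sg * S) * (sg * S - D)
       + (D ^+ 2 - Dl * S ^+ 2) by ring.
    by rewrite h0 mul0r add0r subr_le0.
  rewrite pmulr_rle0 ?Om_gt0 // => S2.
  have : S == 0 by rewrite -sqrf_eq0 eq_le S2 sqr_ge0.
  rewrite mulf_eq0 invr_eq0 pnatr_eq0 orbF paddr_eq0 -?expr2 ?sqr_ge0 //.
  by rewrite !sqrf_eq0 => /andP[/eqP -> /eqP ->].
have r1 : r <= 1 by rewrite ge_min lexx.
have reta : r * (M + 1) <= eta.
  by rewrite -ler_pdivlMr ?ltr_wpDl // ge_min lexx orbT.
have bx t : `|g t 0 0| <= r by have := gN t 0; rewrite mxE subr0 => /ltW.
have by_ t : `|g t 0 1| <= r by have := gN t 1; rewrite mxE subr0 => /ltW.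
have bw t : `|g t 0 2 - 1 / d| <= r by have := gN t 2; rewrite mxE => /ltW.
have hle t : `|hq (g t 0 0) (g t 0 1)| <= eta.
  have xx : `|g t 0 0 * g t 0 0| <= r.
    by rewrite normrM -[leRHS]mulr1 ler_pM // (le_trans (bx t)).
  have yy : `|g t 0 1 * g t 0 1| <= r.
    by rewrite normrM -[leRHS]mulr1 ler_pM // (le_trans (by_ t)).
  have xy : `|g t 0 0 * g t 0 1| <= r.
    by rewrite normrM -[leRHS]mulr1 ler_pM // (le_trans (by_ t)).
  apply: le_trans reta; rewrite /hq.
  set X := g t 0 0 * g t 0 0 in xx *; set Y := g t 0 1 * g t 0 1 in yy *.
  set Z := g t 0 0 * g t 0 1 in xy *; clearbody X Y Z.
  apply: (@le_trans _ _ (`|k| * r + 2 * `|c| * r + `|sg| * r)); last first.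
    by rewrite -!mulrDl mulrC ler_wpM2l ?(ltW r0) // lerDl ler01.
  rewrite (le_trans (ler_normD _ _)) // lerD //.
    rewrite (le_trans (ler_normB _ _)) // lerD //.
      rewrite mulNr normrN !normrM (@ger0_norm _ 2^-1) // -mulrA ler_wpM2l //.
      rewrite mulrC; have := ler_normB X Y; lra.
    by rewrite 2!normrM (@ger0_norm _ 2) // ler_wpM2l // mulr_ge0.
  rewrite normrM ler_wpM2l // normrM (@ger0_norm _ 2^-1) //.
  by have := ler_normD X Y; lra.
have [|||||||h0 w0] := noorbit _ _ _ _ _ (orbit_reduced Dl0 sol) T0 _ _ _ _ _ _ _ 0.
- by move=> t; rewrite !gT.
- by move=> t; rewrite !gT.
- by move=> t; rewrite !gT.
- by move=> t; rewrite !gT.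
- by move=> t; have [] := hsg (g t 0 0) (g t 0 1).
- exact: hle.
- by move=> t; rewrite (le_trans (bw t)) // (le_trans _ reta) // ler_peMr ?(ltW r0) // lerDr.
have [x0 y0] := (hsg _ _).2 h0.
apply: g0; apply/rowP => -[[|[|[|//]]] j3]; rewrite !mxE /=.
- by rewrite -[RHS]x0; congr (g 0 _ _); exact/val_inj.
- by rewrite -[RHS]y0; congr (g 0 _ _); exact/val_inj.
- apply/eqP; rewrite -subr_eq0; apply/eqP; rewrite -[RHS]w0.
  by congr (g 0 _ _ - _); exact/val_inj.
Qed.
End Forward.
End Orbits.

(** * Antiderivatives *)

Section Primitive.
Variable R : realType.
Implicit Types f : R -> R.

Lemma is_derive0_eq f (a x y : R) :
  (forall t, a < t -> is_derive t (1 : R) f 0) -> a < x -> a < y -> f x = f y.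
Proof.
move=> f0; wlog xy : x y / x <= y.
  by move=> H ax ay; have [xy|/ltW yx] := leP x y; [exact: H|apply/esym/H].
move=> ax ay; have fc : {within `[x, y], continuous f}.
  apply: continuous_in_subspaceT => t; rewrite inE /= in_itv /= => /andP[xt _].
  exact: is_derive_continuous (f0 t (lt_le_trans ax xt)).
have f0' (t : R) : t \in `]x, y[%R -> is_derive t (1 : R) f (cst 0 t).
  by rewrite in_itv /= => /andP[xt _]; apply: f0; exact: lt_trans xt.
have [c _] := MVT_segment xy f0' fc.
by rewrite mul0r => /eqP; rewrite subr_eq0 eq_sym => /eqP.
Qed.

Let G f n (t : R) : R := (\int[lebesgue_measure]_(s in `[- n%:R, t]) f s)%R.

Let G' f n (t : R) : continuous f -> - n%:R < t -> is_derive t (1 : R) (G f n) (f t).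
Proof.
move=> fc nt.
have fi : lebesgue_measure.-integrable `[- n%:R, t + 1] (EFin \o f).
  apply: continuous_compact_integrable; first exact: segment_compact.
  by apply: continuous_subspaceT.
have t1 : t < t + 1 by rewrite ltrDl.
have [Gd Gf] := continuous_FTC1_closed t1 fi nt (fc t).
by apply: DeriveDef; [exact: Gd | rewrite -derive1E; exact: Gf].
Qed.

(** Integrals from [- n] are antiderivatives on the half-line after [- n]; they
    agree up to constants, hence glue. *)
Lemma continuous_primitive f : continuous f ->
  exists F : R -> R, forall t : R, is_derive t (1 : R) F (f t).
Proof.
move=> fc; pose N (t : R) := (Num.truncn `|t|).+1.
have tN t : `|t| < (N t)%:R by exact: truncnS_gt.
pose F t := G f (N t) t - G f (N t) 0.
have FE m (t : R) : `|t| < m%:R -> F t = G f m t - G f m 0.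
  move=> tm; pose n := minn m (N t).
  have tn : `|t| < n%:R.
    by rewrite /n /minn; case: ifP => // _; exact: tN.
  pose H s := G f (N t) s - G f m s.
  suff : H t = H 0 by rewrite /F /H => HE; lra.
  apply: (@is_derive0_eq H (- n%:R)).
  - move=> s ns; rewrite -(subrr (f s)) /H.
    have s1 := @G' f (N t) s fc; have s2 := @G' f m s fc.
    apply: der_D; [apply: s1|apply/der_N/s2].
      by apply: le_lt_trans ns; rewrite lerN2 ler_nat geq_minr.
    by apply: le_lt_trans ns; rewrite lerN2 ler_nat geq_minl.
  - by move: tn; rewrite ltr_norml => /andP[].
  - by rewrite oppr_lt0; apply: le_lt_trans tn.
exists F => t.
have : is_derive t (1 : R) (fun s => G f (N t) s - G f (N t) 0) (f t).
  have Nt : - (N t)%:R < t by have := tN t; rewrite ltr_norml => /andP[].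
  have F' := der_D (@G' f (N t) t fc Nt) (der_cst t 1 (- G f (N t) 0)).
  exact: der_eq F' (addr0 _).
apply: near_eq_is_derive; near=> s; apply/esym/FE.
near: s; apply: (@cvgr_lt _ _ _ _ (fun s : R => `|s|) `|t|); last exact: tN.
exact: norm_continuous.
Unshelve. all: by end_near. Qed.

End Primitive.

(** * Periods of the orbits when b = c = 0 *)

Section Trigo.
Variable R : realType.

Lemma periodic_int (f : R -> R) (T : R) (k : int) (x : R) :
  (forall y, f (y + T) = f y) -> f (x + k%:~R * T) = f x.
Proof.
move=> fT; have fTn n y : f (y + n%:R * T) = f y.
  elim: n => [|n IH]; first by rewrite mul0r addr0.
  by rewrite -natr1 mulrDl mul1r addrA fT.
case: k => n; first exact: fTn.
by rewrite NegzE mulrNz mulNr -[LHS](fTn n.+1) subrK.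
Qed.

Lemma cos_eq1_2pi (x : R) : cos x = 1 -> exists k : int, x = k%:~R * (2 * pi).
Proof.
move=> x1; have p0 : 0 < 2 * pi :> R by rewrite mulr_gt0 // pi_gt0.
pose k := Num.floor (x / (2 * pi)); pose r := x - k%:~R * (2 * pi).
have kx : k%:~R * (2 * pi) <= x by rewrite -ler_pdivlMr // floor_le_tmp.
have xk : x < (k + 1)%:~R * (2 * pi) by rewrite -ltr_pdivrMr // floorD1_gt.
have cr : cos r = 1.
  rewrite -x1 -[x in RHS](subrK (k%:~R * (2 * pi))) -/r; apply/esym.
  apply: periodic_int => y; rewrite mulr_natl; exact: cosD2pi.
exists k; apply/eqP; rewrite -subr_eq0 -/r.
have r0 : 0 <= r by rewrite subr_ge0.
have r2 : r < 2 * pi by rewrite /r ltrBlDl; rewrite intrD mulrDl mul1r in xk.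
have [rp|rp] := leP r pi.
  apply/eqP; apply: cos_inj; rewrite ?in_itv /= ?r0 ?rp ?lexx ?pi_ge0 //.
  by rewrite cr cos0.
have : 2 * pi - r = 0.
  apply: cos_inj; rewrite ?in_itv /= ?lexx ?pi_ge0 //; first by apply/andP; split; lra.
  rewrite cosB mulr_natl cos2pi sin2pi cr cos0; ring.
by move=> ?; lra.
Qed.

Lemma is_derive_unique (f : R -> R) (t l l' : R) :
  is_derive t (1 : R) f l -> is_derive t (1 : R) f l' -> l = l'.
Proof.
by move=> fl fl'; rewrite -(@derive_val _ _ _ _ _ _ _ fl) (@derive_val _ _ _ _ _ _ _ fl').
Qed.

End Trigo.

Section Period.
Variables (R : realType) (d : R).
Hypothesis d_neq0 : d != 0.
Implicit Types (g : R -> 'rV[R]_3) (W : set 'rV[R]_3).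

Lemma orbit_radius g : solution_on (vfield 0 0 0 d) setT g ->
  forall t, g t 0 0 ^+ 2 + g t 0 1 ^+ 2 = g 0 0 0 ^+ 2 + g 0 0 1 ^+ 2.
Proof.
move=> sol t.
pose S (s : R) : R := g s 0 0 * g s 0 0 + g s 0 1 * g s 0 1.
have : S t = S 0.
  apply: is_derive_0_is_cst => s; have [x' y' _] := solution_coords s d_neq0 sol.
  by rewrite /S; derive_tac; ring.
by rewrite /S !expr2.
Qed.

Lemma orbit_radius_neq0 g T : solution_on (vfield 0 0 0 d) setT g ->
  least_period g T -> g 0 <> E1 d -> g 0 0 0 ^+ 2 + g 0 0 1 ^+ 2 != 0.
Proof.
move=> sol [T0 gT _] g0; apply/eqP => r0; apply: g0.
have xy0 t : g t 0 0 = 0 /\ g t 0 1 = 0.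
  have := orbit_radius sol t; rewrite r0 => /eqP.
  by rewrite paddr_eq0 ?sqr_ge0 // !sqrf_eq0 => /andP[/eqP -> /eqP ->].
pose w (s : R) : R := g s 0 2 - 1 / d.
pose f (s : R) : R := - (1 / (2 * d)) * (w s * w s).
have f' (t : R) : is_derive t (1 : R) f (w t ^+ 2).
  have [_ _ w'] := solution_coords t d_neq0 sol; rewrite -/w in w'.
  by rewrite /f; derive_tac; rewrite -/(w t) (xy0 t).1; field.
have fT t : f (t + T) = f t by rewrite /f /w gT.
have := periodic_ge0_derive T0 fT f' (fun t => sqr_ge0 _) 0 => /eqP.
rewrite sqrf_eq0 subr_eq0 => /eqP z0; have [x0 y0] := xy0 0.
apply/rowP => -[[|[|[|//]]] j3]; rewrite !mxE /=.
- by rewrite -[RHS]x0; congr (g 0 _ _); exact/val_inj.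
- by rewrite -[RHS]y0; congr (g 0 _ _); exact/val_inj.
- by rewrite -[RHS]z0; congr (g 0 _ _); exact/val_inj.
Qed.

(** Along an orbit [(x, y)] rotates by the angle [Th], the antiderivative of the
    angular speed [z = 1 / d + w]. Since [(z ^ 2 / 2)' = z * z'] and
    [(x ^ 2 / 2)' = x * y * z], one has [w = - d * w ^ 2 + (x ^ 2 / 2 - w / d -
    w ^ 2 / 2)'], so that the angle gained in a period [T] is [T / d] minus [d]
    times the integral [J] of [w ^ 2]. It is a multiple of a full turn, and the
    integral is positive because [w] cannot vanish identically. *)
Lemma orbit_period g T r : solution_on (vfield 0 0 0 d) setT g ->
  least_period g T -> g 0 <> E1 d -> (forall t, `|g t 0 2 - 1 / d| <= r) ->
  exists k : int, 0 < T / d ^+ 2 - k%:~R * (2 * pi) / d <= r ^+ 2 * T.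
Proof.
move=> sol gT0 g0 gr; have rho0 := orbit_radius_neq0 sol gT0 g0.
have [T0 gT _] := gT0.
pose x (s : R) : R := g s 0 0; pose y (s : R) : R := g s 0 1.
pose w (s : R) : R := g s 0 2 - 1 / d.
have eqs (t : R) : [/\ is_derive t (1 : R) x ((1 / d + w t) * y t),
    is_derive t (1 : R) y (- (1 / d + w t) * x t)
  & is_derive t (1 : R) w (- d * w t + x t * y t)].
  have [x' y' w'] := solution_coords t d_neq0 sol; split=> //.
    by apply: der_eq x' _; rewrite -/(x t) -/(y t) -/(w t); ring.
  by apply: der_eq y' _; rewrite -/(x t) -/(y t) -/(w t); ring.
have wc : continuous (fun s : R => w s ^+ 2).
  move=> t; have [_ _ w'] := eqs t.
  have w2 : is_derive t (1 : R) (fun s : R => w s * w s)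
    (w t * (- d * w t + x t * y t) + w t * (- d * w t + x t * y t)) by derive_step.
  rewrite (_ : (fun s => w s ^+ 2) = fun s => w s * w s); last exact/funext.
  exact: is_derive_continuous w2.
have [J J'] := continuous_primitive wc.
pose Th (s : R) : R := 1 / d * s - d * J s + 1 / 2 * (x s * x s) - 1 / d * w s
   - 1 / 2 * (w s * w s).
have Th' (t : R) : is_derive t (1 : R) Th (1 / d + w t).
  have [x' y' w'] := eqs t; have Jt := J' t; have i := der_id t.
  by rewrite /Th; derive_tac; field.
have xT t : x (t + T) = x t by rewrite /x gT.
have yT t : y (t + T) = y t by rewrite /y gT.
have wT t : w (t + T) = w t by rewrite /w gT.
have cosTh (t : R) : is_derive t (1 : R) (fun s => cos (Th s)) (- sin (Th t) * (1 / d + w t)).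
  exact: der_comp (is_derive_cos _) (Th' t).
have sinTh (t : R) : is_derive t (1 : R) (fun s => sin (Th s)) (cos (Th t) * (1 / d + w t)).
  exact: der_comp (is_derive_sin _) (Th' t).
pose C (s : R) : R := x s * cos (Th s) - y s * sin (Th s).
pose S (s : R) : R := x s * sin (Th s) + y s * cos (Th s).
have CE : C T = C 0.
  apply: is_derive_0_is_cst => t; have [x' y' _] := eqs t.
  by have ct := cosTh t; have st := sinTh t; rewrite /C; derive_tac; ring.
have SE : S T = S 0.
  apply: is_derive_0_is_cst => t; have [x' y' _] := eqs t.
  by have ct := cosTh t; have st := sinTh t; rewrite /S; derive_tac; ring.
have cosD : cos (Th T - Th 0) = 1.
  apply: (mulfI rho0); rewrite mulr1 cosB -/(x 0) -/(y 0).
  have xE : x T = x 0 by rewrite -[in RHS](xT 0) add0r.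
  have yE : y T = y 0 by rewrite -[in RHS](yT 0) add0r.
  transitivity (C T * C 0 + S T * S 0).
    by rewrite /C /S xE yE; ring.
  rewrite CE SE.
  transitivity ((x 0 ^+ 2 + y 0 ^+ 2) * (cos (Th 0) ^+ 2 + sin (Th 0) ^+ 2)).
    by rewrite /C /S; ring.
  by rewrite cos2Dsin2 mulr1.
have [k kE] := cos_eq1_2pi cosD; exists k.
have -> : T / d ^+ 2 - k%:~R * (2 * pi) / d = J T - J 0.
  rewrite -kE /Th; have := xT 0; have := wT 0; rewrite !add0r => -> ->.
  by field.
apply/andP; split; last first.
  have [c _ ->] := is_derive_MVT J' (ltW T0); rewrite subr0 ler_wpM2r ?(ltW T0) //.
  rewrite -real_normK ?num_real // ler_sqr ?nnegrE ?gr //.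
  exact: le_trans (normr_ge0 _) (gr 0).
have Jm := ndecr_is_derive_ge0 J' (fun t => sqr_ge0 _).
rewrite lt_def subr_ge0 Jm ?(ltW T0) // andbT subr_eq0; apply/eqP => JT0.
have JT t : J (t + T) = J t.
  suff : J (t + T) - J t = J (0 + T) - J 0.
    by rewrite add0r JT0 subrr => /eqP; rewrite subr_eq0 => /eqP.
  apply: (@is_derive_0_is_cst _ (fun s => J (s + T) - J s)) => s.
  have Js := J' s.
  have JsT : is_derive s (1 : R) (fun u => J (u + T)) (w (s + T) ^+ 2 * (1 + 0)).
    exact: der_comp (J' _) (der_D (der_id s) (der_cst s 1 T)).
  by derive_tac; rewrite wT; ring.
have w0 t : w t = 0.
  by have /eqP := periodic_ge0_derive T0 JT J' (fun t => sqr_ge0 _) t;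
    rewrite sqrf_eq0 => /eqP.
have xy0 t : x t * y t = 0.
  have [_ _ w'] := eqs t.
  have w'' : is_derive t (1 : R) w 0.
    by rewrite (_ : w = cst 0); [exact: der_cst | exact/funext].
  by have := is_derive_unique w' w''; rewrite w0 mulr0 add0r.
have yx0 : y 0 * y 0 = x 0 * x 0.
  have [x' y' _] := eqs 0.
  have p : is_derive (0 : R) (1 : R) (fun s => x s * y s)
    (x 0 * (- (1 / d + w 0) * x 0) + y 0 * ((1 / d + w 0) * y 0)) by derive_step.
  have p0 : is_derive (0 : R) (1 : R) (fun s => x s * y s) 0.
    by rewrite (_ : (fun s => x s * y s) = cst 0); [exact: der_cst | exact/funext].
  have := is_derive_unique p p0; rewrite w0 addr0 => E.
  by apply: (mulfI (invr_neq0 d_neq0)); lra.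
move: rho0; rewrite -/(x 0) -/(y 0) !expr2 yx0.
have /eqP := xy0 0; rewrite mulf_eq0 => /orP[/eqP x0|/eqP y0].
  by rewrite x0 mulr0 addr0 eqxx.
by rewrite -yx0 y0 mulr0 addr0 eqxx.
Qed.

(** If all small orbits had the period [T], the remainder of [T / d ^ 2] modulo
    [2 * pi / d] would be positive and, on shrinking orbits, arbitrarily small. *)
Lemma not_isochronous W :
  tangent_space W (E1 d) = center_plane (vfield 0 0 0 d) (E1 d) ->
  ~ isochronous_center_on (vfield 0 0 0 d) (E1 d) W.
Proof.
move=> tW [cW [T [V [pV VT]]]].
have disc : 0 < (1 + 0 * d) * (1 - 0 * d) - 0 ^+ 2 * d ^+ 2.
  by rewrite expr0n /= !mul0r addr0 !subr0 mulr1 ltr01.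
have p0 : 0 < 2 * pi / `|d|.
  by rewrite divr_gt0 ?mulr_gt0 ?pi_gt0 ?normr_gt0.
have close r : 0 < r -> exists k : int,
    0 < T / d ^+ 2 - k%:~R * (2 * pi) / d <= r ^+ 2 * T /\ 0 < T.
  move=> r0; have [g [T' [sol gT' [Wg Vg] g0 gN]]] :=
    center_orbit d_neq0 disc tW cW (nbhs_box (E1 d) r0) pV.
  have TE := VT _ Wg Vg g0 g T' sol erefl gT'; rewrite TE in gT'.
  have [|k kE] := orbit_period (r := r) sol gT' g0.
    by move=> t; have := gN t 2; rewrite mxE => /ltW.
  by exists k; split=> //; case: gT'.
have small m : 0 < m -> exists k : int,
    0 < T / d ^+ 2 - k%:~R * (2 * pi) / d < m.
  move=> m0; have [_ [_ T0]] := close 1 ltr01.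
  pose r := Num.min 1 (m / (2 * T)).
  have r0 : 0 < r by rewrite lt_min ltr01 divr_gt0 ?mulr_gt0.
  have [k [/andP[kl kr] _]] := close r r0; exists k; rewrite kl /=.
  apply: le_lt_trans kr _.
  have : r * (2 * T) <= m by rewrite -ler_pdivlMr ?mulr_gt0 // ge_min lexx orbT.
  have : r ^+ 2 * T <= r * T.
    by rewrite ler_pM2r // expr2 ger_pMl // ge_min lexx.
  lra.
have [k1 /andP[k1l k1r]] := small _ p0.
have [k2 /andP[k2l k2r]] := small _ k1l.
have : 0 < `|(k2 - k1)%:~R * (2 * pi) / d| < 2 * pi / `|d|.
  have -> : (k2 - k1)%:~R * (2 * pi) / d = (T / d ^+ 2 - k1%:~R * (2 * pi) / d)
     - (T / d ^+ 2 - k2%:~R * (2 * pi) / d) by rewrite intrB; ring.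
  by rewrite gtr0_norm ?subr_gt0 // k2r /=; lra.
have -> : `|(k2 - k1)%:~R * (2 * pi) / d| = `|k2 - k1|%:~R * (2 * pi / `|d|).
  rewrite -mulrA normrM [X in _ * X]normrM normfV intr_norm.
  by rewrite (@ger0_norm _ (2 * pi)) // mulr_ge0 // pi_ge0.
rewrite gtr_pMl // pmulr_lgt0 //.
by rewrite -[1]/(1%:~R) ltr_int ltr0z; case: `|k2 - k1|%R => [[|[|]]|].
Qed.
End Period.

(** * Globally Lipschitz differential equations *)

Section RealSequences.
Variable R : realType.

(** The lower bounds [x n - 2 B / 2 ^ n] increase and the upper bounds
    [x n + 2 B / 2 ^ n] decrease: the supremum of the former lies between. *)
Lemma geometric_cauchy (x : nat -> R) (B : R) :
  (forall n, `|x n.+1 - x n| <= B / 2 ^+ n) ->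
  exists l : R, forall n, `|l - x n| <= 2 * B / 2 ^+ n.
Proof.
move=> xB; have B0 : 0 <= B.
  by have := xB 0; rewrite expr0 divr1; exact: le_trans.
have p2 n : 0 < (2 : R) ^+ n by rewrite exprn_gt0.
have half n : B / 2 ^+ n = 2 * (B / 2 ^+ n.+1).
  by rewrite exprS; field; rewrite gt_eqF.
have step m n : `|x (m + n)%N - x m| <= 2 * B / 2 ^+ m - 2 * B / 2 ^+ (m + n).
  elim: n => [|n IH]; first by rewrite addn0 !subrr normr0.
  have := ler_normD (x (m + n)%N - x m) (x (m + n).+1 - x (m + n)%N).
  rewrite addrC subrKA addnS => /le_trans; apply.
  have := xB (m + n)%N; have := half (m + n)%N; have := IH.
  rewrite -!mulrA; lra.
have ab m n : x m - 2 * B / 2 ^+ m <= x n + 2 * B / 2 ^+ n.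
  have q k : 0 <= 2 * B / 2 ^+ k by rewrite divr_ge0 ?mulr_ge0 // ltW.
  have [mn|/ltnW nm] := leqP m n.
    have := step m (n - m)%N; rewrite subnKC // ler_norml => /andP[+ _].
    have := q n; lra.
  have := step n (m - n)%N; rewrite subnKC // ler_norml => /andP[_].
  have := q m; lra.
pose A := range (fun n => x n - 2 * B / 2 ^+ n).
have A0 : A !=set0 by exists (x 0%N - 2 * B / 2 ^+ 0); exists 0%N.
have supA : has_sup A.
  by split=> //; exists (x 0%N + 2 * B / 2 ^+ 0) => _ [m _ <-].
exists (sup A) => n; rewrite ler_distl; apply/andP; split.
  by apply: ub_le_sup; [case: supA | exists n].
by apply: ge_sup => // _ [m _ <-].
Qed.

Lemma le_geometric (x C : R) : (forall n, x <= C / 2 ^+ n) -> x <= 0.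
Proof.
move=> xC; rewrite leNgt; apply/negP => x0.
pose n := (Num.truncn (C / x)).+1.
have : C < x * 2 ^+ n.
  rewrite mulrC -ltr_pdivrMr // (lt_le_trans (truncnS_gt _)) //.
  by rewrite -natrX ler_nat ltnW // ltn_expl.
by rewrite -ltr_pdivrMr ?exprn_gt0 // ltNge xC.
Qed.

End RealSequences.

Section Growth.
Variable R : realType.

Lemma der_expR_lin (k t : R) :
  is_derive t (1 : R) (fun s : R => expR (k * s)) (k * expR (k * t)).
Proof.
have h : is_derive t (1 : R) (fun s : R => k * s) (k * 1) by apply: der_Z; exact: der_id.
apply: der_eq (der_comp (is_derive_expR _) h) _; ring.
Qed.

(** Weighting by [expR (k * |t|)] makes integration a contraction of ratio
    [1 / k] on the whole line at once, so that no gluing of local solutions is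
    required. *)
Lemma growth (F phi : R -> R) (C k : R) : 0 < k -> F 0 = 0 ->
  (forall t, is_derive t (1 : R) F (phi t)) ->
  (forall t, `|phi t| <= C * expR (k * `|t|)) ->
  forall t, `|F t| <= C / k * expR (k * `|t|).
Proof.
move=> k0; have C0 (psi : R -> R) :
    (forall t, `|psi t| <= C * expR (k * `|t|)) -> 0 <= C.
  move=> /(_ 0); rewrite normr0 mulr0 expR0 mulr1; exact: le_trans.
have half (G psi : R -> R) : G 0 = 0 -> (forall t, is_derive t (1 : R) G (psi t)) ->
    (forall t, `|psi t| <= C * expR (k * `|t|)) ->
    forall t, 0 <= t -> G t <= C / k * expR (k * t).
  move=> G0 G' psiC t t0.
  pose H (s : R) : R := C / k * expR (k * s) - G s.
  have H' (s : R) : is_derive s (1 : R) H (C * expR (k * s) - psi s).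
    have es := der_expR_lin k s; have Gs := G' s.
    by rewrite /H; derive_tac; field; rewrite gt_eqF.
  have [c /andP[c0 _] Hc] := is_derive_MVT H' t0.
  have : 0 <= H t - H 0.
    rewrite Hc subr0 mulr_ge0 // subr_ge0.
    by have := psiC c; rewrite (ger0_norm c0) ler_norml => /andP[].
  have : 0 <= C / k by rewrite divr_ge0 ?(C0 psi) ?(ltW k0).
  by rewrite /H G0 mulr0 expR0; lra.
have pos (G psi : R -> R) : G 0 = 0 -> (forall t, is_derive t (1 : R) G (psi t)) ->
    (forall t, `|psi t| <= C * expR (k * `|t|)) ->
    forall t, 0 <= t -> `|G t| <= C / k * expR (k * t).
  move=> G0 G' psiC t t0; apply/ler_normlP; split; last exact: half G' psiC t t0.
  apply: (half (fun s => - G s) (fun s => - psi s)) => //.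
  - by rewrite G0 oppr0.
  - by move=> s; rewrite normrN.
move=> F0 F' phiC t; have [t0|t0] := leP 0 t.
  by rewrite [`|t|]ger0_norm //; exact: pos F' phiC t t0.
rewrite [`|t|]ltr0_norm // -[in leLHS](opprK t).
apply: (pos (fun s => F (- s)) (fun s => - phi (- s))).
- by rewrite oppr0.
- move=> s; apply: der_eq (der_comp (F' _) (der_N (der_id s))) _.
  by rewrite mulrN1.
- by move=> s; rewrite normrN (le_trans (phiC _)) // normrN.
- by rewrite oppr_ge0 ltW.
Qed.

Lemma gronwall (D dD : R -> R) (K : R) : (forall t, 0 <= D t) -> D 0 = 0 ->
  (forall t, is_derive t (1 : R) D (dD t)) -> (forall t, `|dD t| <= K * D t) ->
  forall t, D t = 0.
Proof.
move=> D0 D00 D' dDK t; apply/eqP; rewrite eq_le D0 andbT.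
have bnd s : - (K * D s) <= dD s <= K * D s by rewrite -ler_norml.
have [t0|/ltW t0] := leP 0 t.
  pose H (s : R) : R := - (D s * expR (- K * s)).
  have H' (s : R) : is_derive s (1 : R) H ((K * D s - dD s) * expR (- K * s)).
    have es := der_expR_lin (- K) s; have Ds := D' s.
    by rewrite /H; derive_tac; ring.
  have H'0 s : 0 <= (K * D s - dD s) * expR (- K * s).
    by rewrite mulr_ge0 ?expR_ge0 // subr_ge0; case/andP: (bnd s).
  have := ndecr_is_derive_ge0 H' H'0 t0.
  by rewrite /H D00 mul0r oppr0 oppr_ge0 pmulr_lle0 ?expR_gt0.
pose H (s : R) : R := D s * expR (K * s).
have H' (s : R) : is_derive s (1 : R) H ((dD s + K * D s) * expR (K * s)).
  have es := der_expR_lin K s; have Ds := D' s.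
  by rewrite /H; derive_tac; ring.
have H'0 s : 0 <= (dD s + K * D s) * expR (K * s).
  by rewrite mulr_ge0 ?expR_ge0 //; have /andP[] := bnd s; lra.
have := ndecr_is_derive_ge0 H' H'0 t0.
by rewrite /H D00 mul0r pmulr_lle0 ?expR_gt0.
Qed.
End Growth.

Lemma der_sum (R : realType) (I : finType) (F : I -> R -> R) (dF : I -> R)
    (t : R) : (forall i, is_derive t (1 : R) (F i) (dF i)) ->
  is_derive t (1 : R) (fun s => \sum_i F i s) (\sum_i dF i).
Proof.
move=> F'; rewrite (_ : (fun s => _) = \sum_i F i); last first.
  by apply/funext => s; rewrite fct_sumE.
by elim/big_ind2 : _ => // *; [exact: is_derive_cst | exact: is_deriveD].
Qed.

Lemma sqr_sum_norm (R : realType) (I : finType) (a : I -> R) :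
  (\sum_i `|a i|) * (\sum_i `|a i|) <= #|I|%:R * \sum_i a i * a i.
Proof.
rewrite mulr_suml; apply: (@le_trans _ _
    (\sum_i \sum_j (a i * a i / 2 + a j * a j / 2))).
  apply: ler_sum => i _; rewrite mulr_sumr; apply: ler_sum => j _.
  have := sqr_ge0 (`|a i| - `|a j|).
  by rewrite sqrrB !real_normK ?num_real // !expr2; lra.
have halfE : \sum_i a i * a i / 2 = (\sum_i a i * a i) / 2 by rewrite mulr_suml.
under eq_bigr do rewrite big_split /= sumr_const halfE.
rewrite big_split /= sumr_const sumrMnl halfE -mulrnDl -splitr mulr_natl.
by rewrite lexx.
Qed.

Section PicardLindelof.
Variables (R : realType) (I : finType) (f : (I -> R) -> I -> R) (L : R).
Hypothesis L_gt0 : 0 < L.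
Hypothesis f_lip : forall a b i, `|f a i - f b i| <= L * \sum_j `|a j - b j|.

Definition integral_curve (u : I -> R -> R) :=
  forall i (t : R), is_derive t (1 : R) (u i) (f (u ^~ t) i).

Lemma integral_curve_unique u v : integral_curve u -> integral_curve v ->
  (forall i, u i 0 = v i 0) -> u = v.
Proof.
move=> u' v' uv0.
pose D (t : R) : R := \sum_i (u i t - v i t) * (u i t - v i t).
pose dD (t : R) : R :=
  \sum_i 2 * (u i t - v i t) * (f (u ^~ t) i - f (v ^~ t) i).
have D0 t : 0 <= D t by apply: sumr_ge0 => i _; rewrite -expr2 sqr_ge0.
have D' (t : R) : is_derive t (1 : R) D (dD t).
  apply: der_sum => i; have u1 := u' i t; have v1 := v' i t.
  by derive_tac; ring.
have dDK t : `|dD t| <= 2 * L * #|I|%:R * D t.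
  apply: (@le_trans _ _ (2 * L * ((\sum_i `|u i t - v i t|) *
      (\sum_i `|u i t - v i t|)))); last first.
    by rewrite -[leRHS]mulrA ler_wpM2l ?mulr_ge0 ?(ltW L_gt0) // sqr_sum_norm.
  apply: le_trans (ler_norm_sum _ _ _) _.
  rewrite mulr_suml mulr_sumr; apply: ler_sum => i _.
  by rewrite !normrM (@ger0_norm _ 2) // [leRHS]mulrACA ler_wpM2l ?mulr_ge0.
have D00 : D 0 = 0 by apply: big1 => i _; rewrite uv0 subrr mul0r.
have D_eq0 := gronwall D0 D00 D' dDK.
apply/funext => i; apply/funext => t; apply/eqP; rewrite -subr_eq0 -sqrf_eq0 expr2.
have /eqP := D_eq0 t; rewrite psumr_eq0.
  by move=> /allP /(_ i); rewrite mem_index_enum => /(_ isT).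
by move=> j _; rewrite -expr2 sqr_ge0.
Qed.

Lemma continuous_rhs (u : I -> R -> R) i : (forall j, continuous (u j)) ->
  continuous (fun t => f (u ^~ t) i).
Proof.
move=> uc t; apply/cvgrPdist_le => e e0.
pose e' := e / (L * (#|I|%:R + 1)).
have e'0 : 0 < e' by rewrite divr_gt0 ?mulr_gt0 // ltr_wpDl.
have near_j j : \forall s \near t, `|u j t - u j s| <= e'.
  by have /cvgrPdist_le := uc j t; exact.
have near_all := @filter_forall R I (fun j => [set s | `|u j t - u j s| <= e'])
  (nbhs t) _ near_j.
near=> s; have us : forall j, `|u j t - u j s| <= e' by near: s; exact: near_all.
apply: le_trans (f_lip _ _ _) _.
apply: (@le_trans _ _ (L * \sum_(j : I) e')).
  rewrite ler_wpM2l ?(ltW L_gt0) //; apply: ler_sum => j _.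
  exact: us.
rewrite sumr_const -mulr_natl mulrCA mulrA.
have -> : e = L * (#|I|%:R + 1) * e'.
  by rewrite /e' mulrC divfK // mulf_neq0 ?gt_eqF // ltr_wpDl.
by rewrite ler_wpM2r ?(ltW e'0) // mulrC ler_wpM2l ?(ltW L_gt0) // lerDl.
Unshelve. all: by end_near. Qed.

Lemma picard_step (u : I -> R -> R) (x0 : I -> R) : (forall j, continuous (u j)) ->
  exists v : I -> R -> R, forall i, v i 0 = x0 i /\
    forall t : R, is_derive t (1 : R) (v i) (f (u ^~ t) i).
Proof.
move=> uc; have F i := continuous_primitive (continuous_rhs (i := i) uc).
exists (fun i t => sval (cid (F i)) t - sval (cid (F i)) 0 + x0 i) => i.
split; first by rewrite subrr add0r.
move=> t; have Ft := svalP (cid (F i)) t.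
by derive_tac; ring.
Qed.

Lemma sum_le_card (a : I -> R) (C : R) : (forall i, a i <= C) ->
  \sum_i a i <= #|I|%:R * C.
Proof.
move=> aC; apply: (@le_trans _ _ (\sum_(i : I) C)).
  by apply: ler_sum => i _.
by rewrite sumr_const mulr_natl lexx.
Qed.

(** The weight makes Picard's operator a contraction of ratio 1/2. *)
Lemma picard_contract (u v u' v' : I -> R -> R) (C : R) (k := 2 * (#|I|%:R + 1) * L) :
  (forall i, u' i 0 = v' i 0) ->
  (forall i (t : R), is_derive t (1 : R) (u' i) (f (u ^~ t) i)) ->
  (forall i (t : R), is_derive t (1 : R) (v' i) (f (v ^~ t) i)) ->
  (forall t, \sum_i `|u i t - v i t| <= C * expR (k * `|t|)) ->
  forall t, \sum_i `|u' i t - v' i t| <= C / 2 * expR (k * `|t|).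
Proof.
move=> uv0 u'd v'd uvC t.
have n0 : 0 < #|I|%:R + 1 :> R by rewrite ltr_wpDl.
have k0 : 0 < k by rewrite !mulr_gt0.
have C0 : 0 <= C.
  have := uvC 0; rewrite normr0 mulr0 expR0 mulr1; apply: le_trans.
  by apply: sumr_ge0.
have bi i : `|u' i t - v' i t| <= L * C / k * expR (k * `|t|).
  apply: (@growth R (fun s => u' i s - v' i s)
    (fun s => f (u ^~ s) i - f (v ^~ s) i)) => //.
  - by rewrite uv0 subrr.
  - move=> s; apply: le_trans (f_lip _ _ _) _.
    by rewrite -mulrA ler_wpM2l ?(ltW L_gt0).
apply: le_trans (sum_le_card bi) _; rewrite mulrA ler_wpM2r ?expR_ge0 //.
have -> : #|I|%:R * (L * C / k) = #|I|%:R / (#|I|%:R + 1) * (C / 2).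
  by rewrite /k; field; rewrite gt_eqF ?(gt_eqF L_gt0).
by rewrite ler_piMl ?divr_ge0 // ler_pdivrMr // mul1r lerDl.
Qed.

Theorem picard_lindelof (x0 : I -> R) :
  exists u, integral_curve u /\ forall i, u i 0 = x0 i.
Proof.
pose S := {u : I -> R -> R | forall j, continuous (u j)}.
have step (u : S) : {v : S | forall i, sval v i 0 = x0 i /\
    forall t : R, is_derive t (1 : R) (sval v i) (f (sval u ^~ t) i)}.
  apply: cid; have [v vP] := picard_step x0 (svalP u).
  have vc j : continuous (v j).
    by move=> t; have [_ v'] := vP j; exact: is_derive_continuous (v' t).
  by exists (exist _ v vc).
have c0 j : continuous (fun _ : R => x0 j) by move=> t; exact: cvg_cst.
pose it := nat_rect (fun _ => S) (exist _ (fun j _ => x0 j) c0)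
  (fun _ u => sval (step u)).
pose u n := sval (it n).
have uP n i : u n.+1 i 0 = x0 i /\
    forall t : R, is_derive t (1 : R) (u n.+1 i) (f (u n ^~ t) i).
  exact: (svalP (step (it n))).
have u0 n i : u n i 0 = x0 i by case: n => [//|n]; exact: (uP n i).1.
have uc n i : continuous (u n i) by exact: (svalP (it n)).
pose k := 2 * (#|I|%:R + 1) * L.
have n0 : 0 < #|I|%:R + 1 :> R by rewrite ltr_wpDl.
have k0 : 0 < k by rewrite !mulr_gt0.
pose M : R := \sum_i `|f x0 i| / k.
have M0 : 0 <= M by apply: sumr_ge0 => i _; rewrite divr_ge0 // ltW.
pose E (t : R) : R := expR (k * `|t|).
have E0 t : 0 <= E t by exact: expR_ge0.
have E1 t : 1 <= E t by rewrite /E -expR0 ler_expR mulr_ge0 // ltW.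
have d n t : \sum_i `|u n.+1 i t - u n i t| <= M / 2 ^+ n * E t.
  elim: n t => [|n IH] t.
    rewrite expr0 divr1 mulr_suml; apply: ler_sum => i _.
    apply: (@growth R (fun s => u 1%N i s - u 0%N i s) (fun _ => f x0 i)) => //.
    - by rewrite !u0 subrr.
    - move=> s; have us := (uP 0%N i).2 s; have vs := der_cst s 1 (x0 i).
      apply: der_eq (der_D us (der_N vs)) _.
      by rewrite subr0.
    - by move=> s; rewrite -[leLHS]mulr1; apply: ler_wpM2l => //; exact: E1.
  have -> : M / 2 ^+ n.+1 * E t = M / 2 ^+ n / 2 * E t.
    by rewrite exprS; field; rewrite gt_eqF ?exprn_gt0.
  apply: picard_contract IH t.
  - by move=> i; rewrite !u0.
  - by move=> i t; exact: (uP _ i).2.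
  - by move=> i t; exact: (uP _ i).2.
have di n i t : `|u n.+1 i t - u n i t| <= M * E t / 2 ^+ n.
  rewrite mulrAC (le_trans _ (d n t)) // (bigD1 i) //= lerDl.
  by apply: sumr_ge0.
pose v i t := sval (cid (geometric_cauchy (fun n => di n i t))).
have vu n i t : `|v i t - u n i t| <= 2 * M * E t / 2 ^+ n.
  by rewrite -[2 * M * _]mulrA; exact: (svalP (cid (geometric_cauchy (fun n => di n i t)))).
have vc i : continuous (v i).
  move=> t; apply/cvgrPdist_le => e e0.
  pose B := 2 * M * E (`|t| + 1).
  have [n nB] : exists n, B / 2 ^+ n <= e / 4.
    apply: contrapT => H.
    have : e / 4 <= 0.
      apply: (@le_geometric _ _ B) => n; rewrite leNgt; apply/negP => /ltW eB.
      by apply: H; exists n.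
    by rewrite pmulr_lle0 ?invr_gt0 // leNgt e0.
  have Bs s : `|s| <= `|t| + 1 -> `|v i s - u n i s| <= e / 4.
    move=> st; apply: le_trans (vu n i s) _; apply: le_trans nB.
    rewrite ler_wpM2r ?invr_ge0 ?exprn_ge0 // ler_wpM2l ?mulr_ge0 //.
    by rewrite ler_expR ler_wpM2l ?(ltW k0) // [`|_ + 1|]ger0_norm ?addr_ge0.
  have e4 : 0 < e / 4 by rewrite divr_gt0.
  have ut : \forall s \near t, `|u n i t - u n i s| <= e / 4.
    by have /cvgrPdist_le := uc n i t; exact.
  have st : \forall s \near t, `|t - s| <= 1.
    by have /cvgrPdist_le := @cvg_id _ (nbhs t); exact.
  near=> s.
  have s1 : `|s| <= `|t| + 1.
    have ts : `|t - s| <= 1 by near: s; exact: st.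
    by rewrite -lerBlDl (le_trans (lerB_dist _ _)) // distrC.
  have us : `|u n i t - u n i s| <= e / 4 by near: s; exact: ut.
  have vt := Bs t; rewrite lerDl ler01 in vt; have {}vt := vt isT.
  have vs := Bs s s1.
  move: us vt vs; rewrite !ler_norml => /andP[? ?] /andP[? ?] /andP[? ?].
  by apply/andP; split; lra.
have [w wP] := picard_step x0 vc.
have wv : w = v.
  apply/funext => i; apply/funext => t; apply/eqP; rewrite -subr_eq0 -normr_le0.
  apply: (@le_geometric _ _ ((#|I|%:R + 2) * M * E t)) => n.
  have vun s : \sum_i `|v i s - u n i s| <= 2 * #|I|%:R * M / 2 ^+ n * E s.
    apply: le_trans (sum_le_card (fun i => vu n i s)) _.
    by rewrite le_eqVlt; apply/orP; left; apply/eqP; ring.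
  have wun : \sum_i `|w i t - u n.+1 i t| <= 2 * #|I|%:R * M / 2 ^+ n / 2 * E t.
    apply: picard_contract vun t.
    - by move=> j; rewrite u0 (wP j).1.
    - by move=> j s; exact: (wP j).2.
    - by move=> j s; exact: (uP n j).2.
  have wi : `|w i t - u n.+1 i t| <= #|I|%:R * M / 2 ^+ n * E t.
    apply: (@le_trans _ _ (\sum_i `|w i t - u n.+1 i t|)).
      by rewrite (bigD1 i) //= lerDl; apply: sumr_ge0.
    apply: le_trans wun _.
    by rewrite le_eqVlt; apply/orP; left; apply/eqP; field; rewrite gt_eqF ?exprn_gt0.
  have ui : `|u n.+1 i t - v i t| <= 2 * M * E t / 2 ^+ n.
    rewrite distrC (le_trans (vu n.+1 i t)) // ler_wpM2l ?mulr_ge0 //.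
    by rewrite lef_pV2 ?posrE ?exprn_gt0 // ler_weXn2l ?ler1n.
  have := ler_normD (w i t - u n.+1 i t) (u n.+1 i t - v i t).
  rewrite subrKA => /le_trans; apply; apply: le_trans (lerD wi ui) _.
  by rewrite le_eqVlt; apply/orP; left; apply/eqP; ring.
exists w; split; last by move=> i; rewrite (wP i).1.
by move=> i t; have := (wP i).2 t; rewrite wv.
Unshelve. all: by end_near. Qed.

End PicardLindelof.

(** * Surfaces are local graphs over a transverse direction *)

Section LocalGraph.
Variable R : realType.
Local Notation E := 'rV[R]_3.
Implicit Types (p q : E) (W U N : set E) (F : E -> R).

Lemma nbhs_boxP p (A : set E) : nbhs p A ->
  exists2 r : R, 0 < r & forall q, (forall j, `|q 0 j - p 0 j| < r) -> A q.
Proof.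
move=> /nbhs_ballP [r /= r0 rA]; exists r => // q qr; apply: rA.
rewrite mx_norm_ball /ball_ /= /Num.Def.normr /= mx_normrE.
apply: bigmax_lt => // -[i j] _ /=; rewrite !mxE distrC (ord1 i); exact: qr.
Qed.

Lemma class_C_C1 r U F : class_C r.+1 U F -> forall q, U q ->
  differentiable F q /\ forall i : 'I_3, {for q, continuous ('D_(delta_mx 0 i) F)}.
Proof.
move=> [Fd FD] q Uq; split=> [|i]; first exact: Fd.
case: r FD => [|r] /(_ i) /= FD; first exact: FD.
exact/differentiable_continuous/(FD.1 q Uq).
Qed.

Lemma rV3_decomp (v : E) :
  v = v 0 0 *: delta_mx 0 0 + v 0 1 *: delta_mx 0 1 + v 0 2 *: delta_mx 0 2.
Proof.
apply/rowP => -[[|[|[|//]]] j3]; rewrite !mxE /= ?mulr1 ?mulr0 ?addr0 ?add0r;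
  by congr (v 0 _); exact/val_inj.
Qed.

(** A defining function of [W] vanishes to first order along the curves of [W]. *)
Lemma diff_tangent W U F p v : open U -> U p -> differentiable F p ->
  W `&` U = [set u | U u /\ F u = 0] -> tangent_space W p v -> 'd F p v = 0.
Proof.
move=> Uo Up Fd WU [g [g0 Wg gv]].
have gd : differentiable g 0 by apply/derivable1_diffP; exact: @ex_derive.
have Ug : \forall t \near (0 : R), U (g t).
  by apply: (differentiable_continuous gd); rewrite g0; exact: open_nbhs_nbhs.
have Fg : \forall t \near (0 : R), cst 0 t = (F \o g) t.
  apply: filterS2 Wg Ug => t Wt Ut /=.
  by have : (W `&` U) (g t) by []; rewrite WU => -[_ ->].
have Fg0 := near_eq_is_derive Fg (is_derive_cst (0 : R) (0 : R) (1 : R)).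
have Fd0 : differentiable F (g 0) by rewrite g0.
have := @derive_val _ _ _ _ _ _ _ Fg0; rewrite deriveE; last first.
  exact: differentiable_comp.
rewrite diff_comp // /= g0.
by rewrite -(deriveE (1 : R) gd) (@derive_val _ _ _ _ _ _ _ gv).
Qed.

(** The differential of a defining function is nonzero but vanishes on the
    tangent vectors, which here include all horizontal ones. *)
Lemma transverse_derivative W U F p : open U -> U p -> differentiable F p ->
  W `&` U = [set u | U u /\ F u = 0] -> (exists v, 'd F p v != 0) ->
  (forall v : E, v 0 2 = 0 -> tangent_space W p v) ->
  'D_(delta_mx 0 2) F p != 0.
Proof.
move=> Uo Up Fd WU [v Fv] tW; apply: contraNneq Fv; rewrite deriveE // => F2.
rewrite [v]rV3_decomp linearD linearZ /= F2 scaler0 addr0; apply/eqP.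
apply: (diff_tangent Uo Up Fd WU); apply: tW.
by rewrite !mxE /= !mulr0 addr0.
Qed.

Definition vertical (x y z : R) : E := \row_(j < 3) [:: x; y; z]`_j.

Lemma vertical_eta q : q = vertical (q 0 0) (q 0 1) (q 0 2).
Proof.
by apply/rowP => -[[|[|[|//]]] j3]; rewrite !mxE /=; congr (q 0 _); exact/val_inj.
Qed.

Lemma der_vertical F (x y z : R) : differentiable F (vertical x y z) ->
  is_derive z (1 : R) (fun s => F (vertical x y s))
    ('D_(delta_mx 0 2) F (vertical x y z)).
Proof.
move=> Fd; have FdD : derivable F (vertical x y z) (delta_mx 0 2) by exact: diff_derivable.
have e : (fun h : R => h^-1 *: (F (vertical x y (h *: 1 + z)) - F (vertical x y z)))
  = fun h : R => h^-1 *: (F (h *: delta_mx 0 2 + vertical x y z) - F (vertical x y z)).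
  apply/funext => h; congr (_ *: (F _ - _)); apply/rowP => -[[|[|[|//]]] j3];
    by rewrite !mxE /= ?mulr0 ?add0r.
by apply: DeriveDef; rewrite /derivable /derive /= e.
Qed.

Definition box p (dl et : R) : set E := [set q |
  [/\ `|q 0 0 - p 0 0| <= dl, `|q 0 1 - p 0 1| <= dl & `|q 0 2 - p 0 2| <= et]].

Lemma compact_box p dl et : compact (box p dl et).
Proof.
pose A (i : 'I_3) : set R := [set` `[p 0 i - [:: dl; dl; et]`_i,
                                    p 0 i + [:: dl; dl; et]`_i]].
have AC : compact [set v : E | forall i, A i (v ord0 i)].
  by apply: rV_compact => i; exact: segment_compact.
rewrite (_ : box p dl et = [set v : E | forall i, A i (v ord0 i)]) //.
apply/seteqP; split=> q /=.
  move=> [q0 q1 q2] -[[|[|[|//]]] j3]; rewrite /A /= in_itv /= -ler_distl.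
  - by apply: le_trans q0; rewrite le_eqVlt; apply/orP; left; apply/eqP;
      congr (`|q _ _ - p _ _|); exact/val_inj.
  - by apply: le_trans q1; rewrite le_eqVlt; apply/orP; left; apply/eqP;
      congr (`|q _ _ - p _ _|); exact/val_inj.
  - by apply: le_trans q2; rewrite le_eqVlt; apply/orP; left; apply/eqP;
      congr (`|q _ _ - p _ _|); exact/val_inj.
by move=> Aq; split; have := Aq _; rewrite /A /= => H;
  [have := H 0 | have := H 1 | have := H 2]; rewrite in_itv /= -ler_distl.
Qed.

(** The uniqueness half of the implicit function theorem: in a small box the
    defining function is strictly monotone in the vertical direction, and it has
    opposite signs near the top and the bottom. *)
Lemma local_graph r W p N : C_surface r.+1 W -> W p ->
  (forall v : E, v 0 2 = 0 -> tangent_space W p v) -> nbhs p N ->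
  exists dl et : R, [/\ 0 < dl, 0 < et, box p dl et `<=` N,
    (forall q q', (W `&` box p dl et) q -> (W `&` box p dl et) q' ->
      q 0 0 = q' 0 0 -> q 0 1 = q' 0 1 -> q = q')
    & (forall q, (W `&` box p dl et) q -> `|q 0 2 - p 0 2| < et / 2) /\
      compact (W `&` box p dl et)].
Proof.
move=> Ws Wp tW pN; have [U [F [Uo Up Fr Fdiff WU]]] := Ws p Wp.
have FC1 := class_C_C1 Fr.
have [Fd FD] := FC1 p Up.
have Fp2 := transverse_derivative Uo Up Fd WU (Fdiff p Up) tW.
set k := 'D_(delta_mx 0 2) F p in Fp2.
have kpos : \forall q \near p, 0 < k * 'D_(delta_mx 0 2) F q.
  have kc : {for p, continuous (fun q => k * 'D_(delta_mx 0 2) F q)}.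
    by apply: continuousM; [exact: cst_continuous | exact: FD].
  have k2 : 0 < k * k by rewrite lt_def mulf_neq0 //= -expr2 sqr_ge0.
  exact: (cvgr_gt (k * k) kc _ k2).
have [r0 r0_gt0 r0P] : exists2 r : R, 0 < r & forall q,
    (forall j, `|q 0 j - p 0 j| < r) ->
    [/\ N q, U q & 0 < k * 'D_(delta_mx 0 2) F q].
  apply: nbhs_boxP; apply: filterS3 pN (open_nbhs_nbhs (conj Uo Up)) kpos.
  by move=> q Nq Uq kq; split.
pose h : R := r0 / 2.
have h0 : 0 < h by rewrite divr_gt0.
have hr : h < r0 by rewrite /h; lra.
pose Q x y w : E := vertical (p 0 0 + x) (p 0 1 + y) (p 0 2 + w).
have QB x y w : `|x| <= h -> `|y| <= h -> `|w| <= h ->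
    [/\ N (Q x y w), U (Q x y w) & 0 < k * 'D_(delta_mx 0 2) F (Q x y w)].
  move=> xh yh wh; apply: r0P => -[[|[|[|//]]] j3]; rewrite !mxE /=.
  - rewrite (_ : Ordinal j3 = 0); last exact/val_inj.
    by rewrite addrC addKr (le_lt_trans xh).
  - rewrite (_ : Ordinal j3 = 1); last exact/val_inj.
    by rewrite addrC addKr (le_lt_trans yh).
  - rewrite (_ : Ordinal j3 = 2); last exact/val_inj.
    by rewrite addrC addKr (le_lt_trans wh).
(* [k * F] increases along the vertical segments of the box. *)
have mono x y w1 w2 : `|x| <= h -> `|y| <= h -> `|w1| <= h -> `|w2| <= h ->
    w1 < w2 -> k * F (Q x y w1) < k * F (Q x y w2).
  move=> xh yh w1h w2h w12.
  have dF s : p 0 2 + w1 <= s <= p 0 2 + w2 ->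
      0 < k * 'D_(delta_mx 0 2) F (vertical (p 0 0 + x) (p 0 1 + y) s) /\
      is_derive s (1 : R) (fun s => k * F (vertical (p 0 0 + x) (p 0 1 + y) s))
      (k * 'D_(delta_mx 0 2) F (vertical (p 0 0 + x) (p 0 1 + y) s)).
    move=> sw; have sE : s = p 0 2 + (s - p 0 2) by rewrite addrC subrK.
    have swh : `|s - p 0 2| <= h.
      move: w1h w2h; rewrite !ler_norml => /andP[? ?] /andP[? ?].
      by apply/andP; move/andP: sw => [? ?]; split; lra.
    have [_ Us kDs] := QB x y (s - p 0 2) xh yh swh.
    rewrite /Q -sE in Us kDs; split=> //; apply: der_Z; apply: der_vertical.
    exact: (FC1 _ Us).1.
  have lt12 : p 0 2 + w1 < p 0 2 + w2 by rewrite ltrD2l.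
  pose f s := k * F (vertical (p 0 0 + x) (p 0 1 + y) s).
  pose df s := k * 'D_(delta_mx 0 2) F (vertical (p 0 0 + x) (p 0 1 + y) s).
  have d1 s : s \in `]p 0 2 + w1, p 0 2 + w2[%R -> is_derive s (1 : R) f (df s).
    by rewrite in_itv /= => /andP[s1 s2]; apply: (dF s _).2; rewrite !ltW.
  have c1 : {within `[p 0 2 + w1, p 0 2 + w2], continuous f}.
    apply: derivable_within_continuous => s; rewrite in_itv /= => sw.
    by have [_ ?] := dF s sw; exact: @ex_derive.
  have [c cw e] := MVT_segment (ltW lt12) d1 c1.
  rewrite -subr_gt0 [ltRHS]e mulr_gt0 ?subr_gt0 //.
  by rewrite in_itv /= in cw; exact: (dF c cw).1.
have Fp : F p = 0.
  by have : (W `&` U) p by []; rewrite WU => -[].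
have Q0 : Q 0 0 0 = p by rewrite /Q !addr0 -vertical_eta.
have Fp0 : k * F (Q 0 0 0) = 0 by rewrite Q0 Fp mulr0.
have h2h : `|h / 2| <= h by rewrite ger0_norm ?divr_ge0 ?(ltW h0) //; lra.
have n0h : `|0 : R| <= h by rewrite normr0 ltW.
have top : 0 < k * F (Q 0 0 (h / 2)).
  by rewrite -[ltLHS]Fp0; apply: mono => //; rewrite divr_gt0.
have bot : k * F (Q 0 0 (- (h / 2))) < 0.
  rewrite -[ltRHS]Fp0; apply: mono; rewrite ?normrN //.
  by rewrite oppr_lt0 divr_gt0.
have near_sign w : `|w| <= h ->
    exists2 r : R, 0 < r & forall x y, `|x| < r -> `|y| < r ->
      (0 < k * F (Q 0 0 w) -> 0 < k * F (Q x y w)) /\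
      (k * F (Q 0 0 w) < 0 -> k * F (Q x y w) < 0).
  move=> wh; have [_ Uq _] := QB 0 0 w n0h n0h wh.
  have kc : {for Q 0 0 w, continuous (fun q => k * F q)}.
    apply: continuousM; first exact: cst_continuous.
    exact: differentiable_continuous (FC1 _ Uq).1.
  have sgn : \forall q \near Q 0 0 w,
      (0 < k * F (Q 0 0 w) -> 0 < k * F q) /\ (k * F (Q 0 0 w) < 0 -> k * F q < 0).
    have [s0|s0|s0] := ltgtP (k * F (Q 0 0 w)) 0.
    - by apply: filterS (cvgr_lt _ kc _ s0) => q; split.
    - by apply: filterS (cvgr_gt _ kc _ s0) => q; split.
    - by apply: filterE => q; split.
  have [s s_gt0 sP] := nbhs_boxP sgn; exists s => // x y xs ys; apply: sP.
  move=> -[[|[|[|//]]] j3]; rewrite !mxE /=.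
  - by rewrite addr0 addrC addKr.
  - by rewrite addr0 addrC addKr.
  - by rewrite subrr normr0.
have [r1 r1_gt0 r1P] := near_sign (h / 2) h2h.
have [|r2 r2_gt0 r2P] := near_sign (- (h / 2)); first by rewrite normrN.
(* Over this smaller base the signs at heights [h / 2] and [- h / 2] persist. *)
pose dl : R := Num.min h (Num.min (r1 / 2) (r2 / 2)).
have dl0 : 0 < dl by rewrite !lt_min h0 !divr_gt0.
have dlh : dl <= h by rewrite ge_min lexx.
have dl1 : dl < r1.
  by have : dl <= r1 / 2; [rewrite !ge_min lexx orbT | lra].
have dl2 : dl < r2.
  by have : dl <= r2 / 2; [rewrite !ge_min lexx !orbT | lra].
have boxQ q : box p dl h q -> exists x y w,
    [/\ q = Q x y w, `|x| <= dl, `|y| <= dl & `|w| <= h].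
  move=> [qx qy qw]; exists (q 0 0 - p 0 0), (q 0 1 - p 0 1), (q 0 2 - p 0 2).
  by split=> //; rewrite /Q !subrKC -vertical_eta.
have WF q : (W `&` box p dl h) q -> F q = 0.
  move=> [Wq /boxQ [x [y [w [qE xd yd wh]]]]].
  have [_ Uq _] := QB x y w (le_trans xd dlh) (le_trans yd dlh) wh.
  have : (W `&` U) q by rewrite qE in Wq *.
  by rewrite WU => -[].
exists dl, h; split=> //.
- move=> q /boxQ [x [y [w [-> xd yd wh]]]].
  by have [] := QB x y w (le_trans xd dlh) (le_trans yd dlh) wh.
- move=> q q' Wq Wq' q0 q1; have Fq := WF _ Wq; have Fq' := WF _ Wq'.
  have [_ [x0d y0d w0h]] := Wq; have [_ [_ _ w0h']] := Wq'.
  have qE : q = Q (q 0 0 - p 0 0) (q 0 1 - p 0 1) (q 0 2 - p 0 2).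
    by rewrite /Q !subrKC -vertical_eta.
  have qE' : q' = Q (q 0 0 - p 0 0) (q 0 1 - p 0 1) (q' 0 2 - p 0 2).
    by rewrite /Q !subrKC q0 q1 -vertical_eta.
  have mm := mono _ _ _ _ (le_trans x0d dlh) (le_trans y0d dlh).
  have [lt|lt|e] := ltgtP (q 0 2 - p 0 2) (q' 0 2 - p 0 2).
  - by have := mm _ _ w0h w0h' lt; rewrite -qE -qE' Fq Fq' ltxx.
  - by have := mm _ _ w0h' w0h lt; rewrite -qE -qE' Fq Fq' ltxx.
  - by rewrite qE e -qE'.
split.
- move=> q Wq; have Fq := WF _ Wq; have [_ [x0d y0d w0h]] := Wq.
  have qE : q = Q (q 0 0 - p 0 0) (q 0 1 - p 0 1) (q 0 2 - p 0 2).
    by rewrite /Q !subrKC -vertical_eta.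
  have mm := mono _ _ _ _ (le_trans x0d dlh) (le_trans y0d dlh).
  rewrite ltNge; apply/negP => hw.
  have topq := (r1P _ _ (le_lt_trans x0d dl1) (le_lt_trans y0d dl1)).1 top.
  have botq := (r2P _ _ (le_lt_trans x0d dl2) (le_lt_trans y0d dl2)).2 bot.
  have kq : k * F q = 0 by rewrite Fq mulr0.
  have [w0|w0] := leP 0 (q 0 2 - p 0 2).
    rewrite ger0_norm // in hw; move: hw; rewrite le_eqVlt => /orP[/eqP hw|hw].
      by move: topq; rewrite hw -qE kq ltxx.
    have := lt_trans topq (mm _ _ h2h w0h hw).
    by rewrite -qE kq ltxx.
  rewrite ltr0_norm // lerNr in hw; move: hw; rewrite le_eqVlt => /orP[/eqP hw|hw].
    by move: botq; rewrite -hw -qE kq ltxx.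
  have nh : `|- (h / 2)| <= h by rewrite normrN.
  have := lt_trans (mm _ _ w0h nh hw) botq.
  by rewrite -qE kq ltxx.
rewrite (_ : W `&` box p dl h = box p dl h `&` closure (W `&` box p dl h)).
  by apply: compact_closedI; [exact: compact_box | exact: closed_closure].
apply/seteqP; split=> q; first by move=> Wq; split; [case: Wq | exact: subset_closure].
move=> [Bq cq]; split=> //.
have [x [y [w [qE xd yd wh]]]] := boxQ _ Bq.
have [_ Uq _] := QB x y w (le_trans xd dlh) (le_trans yd dlh) wh.
rewrite -qE in Uq.
suff Fq : F q = 0.
  by have [] : (W `&` U) q by rewrite WU; split.
apply/eqP; apply: contraT => Fq.
have Fc : {for q, continuous F} by exact: differentiable_continuous (FC1 _ Uq).1.
have nF : \forall q' \near q, F q' != 0 by exact: cvgr_neq0 Fc Fq.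
by have [q' [Wq' /eqP]] := cq _ nF; rewrite (WF _ Wq').
Qed.
End LocalGraph.

(** * The center at b = c = 0 *)

Section Confinement.
Variable R : realType.

(** If |w| < b on a symmetric interval already forces |w| <= a < b there, then
    |w| never reaches b: on the largest such interval |w| <= a up to and
    including the endpoints, so the interval can be enlarged. *)
Lemma confined (w : R -> R) (a b : R) : continuous w -> a < b -> `|w 0| < b ->
  (forall s, 0 < s -> (forall u, `|u| < s -> `|w u| < b) ->
    forall u, `|u| < s -> `|w u| <= a) ->
  forall t, `|w t| <= a.
Proof.
move=> wc ab w0 step.
have nwc : continuous (fun t => `|w t|).
  by move=> t; apply: continuous_comp; [exact: wc | exact: norm_continuous].
have near_lt t : `|w t| < b ->
    exists2 r : R, 0 < r & forall s, `|s - t| < r -> `|w s| < b.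
  move=> tb; have : nbhs t [set s | `|w s| < b] by exact: cvgr_lt (nwc t) _ tb.
  move=> /nbhs_ballP [r /= r0 rb]; exists r => // s st; apply: rb.
  by rewrite /ball /= distrC.
pose S : set R := [set s | 0 < s /\ forall u, `|u| < s -> `|w u| < b].
have [r0 r0_gt0 r0b] := near_lt 0 w0.
have S0 : S r0 by split=> // u ur; apply: r0b; rewrite subr0.
have [ubS|nubS] := pselect (has_ubound S); last first.
  move=> t; have [s Ss ts] : exists2 s, S s & `|t| < s.
    apply: contrapT => H; apply: nubS; exists `|t| => s Ss.
    by rewrite leNgt; apply/negP => ts; apply: H; exists s.
  by have [s0 sb] := Ss; exact: step s0 sb t ts.
exfalso; pose m := sup S.
have supS : has_sup S by split => //; exists r0.
have m0 : 0 < m by apply: lt_le_trans r0_gt0 _; exact: ub_le_sup.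
have mb u : `|u| < m -> `|w u| < b.
  by move=> /(sup_gt supS.1) [s [s0 sb] us]; exact: sb.
have ma := step m m0 mb.
have enda t : `|t| = m -> `|w t| <= a.
  move=> tm; rewrite leNgt; apply/negP => at_.
  have : nbhs t [set s | a < `|w s|] by exact: cvgr_gt (nwc t) _ at_.
  move=> /nbhs_ballP [r /= r_gt0 rb].
  (* Moving [t] slightly inwards contradicts the bound on the open interval. *)
  pose k := Num.min (r / (2 * m)) (1 / 2).
  have k0 : 0 < k by rewrite lt_min !divr_gt0 ?mulr_gt0.
  have k1 : k <= 1 / 2 by rewrite ge_min lexx orbT.
  have kr : k * (2 * m) <= r by rewrite -ler_pdivlMr ?mulr_gt0 // ge_min lexx.
  have km : 0 < k * m by rewrite mulr_gt0.
  have := rb (t * (1 - k)); rewrite /ball /= => /(_ _) H.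
  have : a < `|w (t * (1 - k))|.
    apply: H; rewrite (_ : t - t * (1 - k) = t * k); last by ring.
    by rewrite normrM tm (ger0_norm (ltW k0)) mulrC; lra.
  rewrite ltNge ma // normrM tm ger0_norm; last by lra.
  by rewrite mulrBr mulr1 mulrC; lra.
have [r1 r1_gt0 r1b] := near_lt m (le_lt_trans (enda m (ger0_norm (ltW m0))) ab).
have nm : `|- m| = m by rewrite normrN ger0_norm // ltW.
have [r2 r2_gt0 r2b] := near_lt (- m) (le_lt_trans (enda (- m) nm) ab).
pose r := Num.min r1 r2; have r_gt0 : 0 < r by rewrite lt_min r1_gt0.
have : S (m + r / 2).
  split; first by rewrite addr_gt0 ?divr_gt0.
  move=> u ur; have [um|mu] := ltP `|u| m; first exact: mb.
  have rr1 : r <= r1 by rewrite ge_min lexx.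
  have rr2 : r <= r2 by rewrite ge_min lexx orbT.
  have [u0|u0] := leP 0 u.
    apply: r1b; rewrite ger0_norm // in ur mu *.
    by rewrite ger0_norm ?subr_ge0 //; lra.
  apply: r2b; rewrite ltr0_norm // in ur mu.
  by rewrite opprK ler0_norm; lra.
move=> /(ub_le_sup ubS); rewrite -/m; lra.
Qed.

End Confinement.

Lemma angle_exists (R : realType) (u v : R) : u ^+ 2 + v ^+ 2 = 1 ->
  exists2 al : R, `|al| <= pi & cos al = u /\ sin al = v.
Proof.
move=> uv; have u1 : -1 <= u <= 1.
  rewrite -ler_norml -ler_sqr ?nnegrE // expr1n real_normK ?num_real //.
  by have := sqr_ge0 v; lra.
have cu : cos (acos u) = u by apply: acosK; rewrite in_itv.
have su : sin (acos u) = `|v|.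
  by rewrite sin_acos // -uv [_ + v ^+ 2]addrC addrK sqrtr_sqr.
have [a0 ap] : 0 <= acos u /\ acos u <= pi by split; [exact: acos_ge0 | exact: acos_lepi].
have [v0|v0] := leP 0 v.
  exists (acos u); first by rewrite ger0_norm.
  by rewrite cu su ger0_norm.
exists (- acos u); first by rewrite normrN ger0_norm.
by rewrite cosN sinN cu su ltr0_norm // opprK.
Qed.

Section CenterDynamics.
Variables (R : realType) (d x0 y0 w0 : R).
Hypothesis d_neq0 : d != 0.
Hypothesis r_neq0 : x0 ^+ 2 + y0 ^+ 2 != 0.

(** The orbit of [(x0, y0)] under rotations of angle [- p]. *)
Let X (p : R) : R := x0 * cos p + y0 * sin p.
Let Y (p : R) : R := y0 * cos p - x0 * sin p.

Lemma rotation_radius p : X p ^+ 2 + Y p ^+ 2 = x0 ^+ 2 + y0 ^+ 2.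
Proof.
have -> : X p ^+ 2 + Y p ^+ 2 = (x0 ^+ 2 + y0 ^+ 2) * (cos p ^+ 2 + sin p ^+ 2).
  by rewrite /X /Y; ring.
by rewrite cos2Dsin2 mulr1.
Qed.

Lemma rotation_fixed p : X p = x0 -> Y p = y0 -> cos p = 1.
Proof.
move=> Xp Yp; apply: (mulfI r_neq0); rewrite mulr1.
transitivity (x0 * X p + y0 * Y p); first by rewrite /X /Y; ring.
by rewrite Xp Yp !expr2.
Qed.

Lemma rotation_onto x y : x ^+ 2 + y ^+ 2 = x0 ^+ 2 + y0 ^+ 2 ->
  exists2 al : R, `|al| <= pi & X al = x /\ Y al = y.
Proof.
pose r := x0 ^+ 2 + y0 ^+ 2; rewrite -/r => xy; have r0 : r != 0 := r_neq0.
have [|al alpi [ca sa]] := @angle_exists R ((x * x0 + y * y0) / r) ((x * y0 - y * x0) / r).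
  rewrite (_ : _ + _ = (x ^+ 2 + y ^+ 2) * r / r ^+ 2); last first.
    by rewrite /r; field.
  by rewrite xy; field.
exists al => //; rewrite /X /Y ca sa; split; rewrite /r; field; exact: r_neq0.
Qed.

Lemma der_X (p : R) : is_derive p (1 : R) X (Y p).
Proof.
by have c := is_derive_cos p; have s := is_derive_sin p; rewrite /X /Y; derive_tac; ring.
Qed.

Lemma der_Y (p : R) : is_derive p (1 : R) Y (- X p).
Proof.
by have c := is_derive_cos p; have s := is_derive_sin p; rewrite /X /Y; derive_tac; ring.
Qed.

Let m := `|x0| + `|y0|.

Lemma rotation_bound p : `|X p| <= m /\ `|Y p| <= m.
Proof.
have le1 (a z : R) : `|z| <= 1 -> `|a * z| <= `|a|.
  by move=> z1; rewrite normrM ler_piMr.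
rewrite /X /Y /m; split.
  by rewrite (le_trans (ler_normD _ _)) // lerD // le1 ?cos_max ?sin_max.
rewrite (le_trans (ler_normB _ _)) // addrC lerD // le1 ?cos_max ?sin_max //.
Qed.

Lemma forcing_lipschitz p q : `|X p * Y p - X q * Y q| <= 2 * m ^+ 2 * `|p - q|.
Proof.
wlog qp : p q / q <= p.
  move=> H; have [qp|/ltW pq] := leP q p; first exact: H.
  by rewrite distrC [`|p - q|]distrC; exact: H.
pose f (s : R) : R := X s * Y s; pose df (s : R) : R := Y s * Y s - X s * X s.
have f' (s : R) : is_derive s (1 : R) f (df s).
  by have Xs := der_X s; have Ys := der_Y s; rewrite /f /df; derive_tac; ring.
have [c _ e] := is_derive_MVT f' qp.
rewrite -/(f p) -/(f q) e normrM ler_wpM2r //.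
have [Xc Yc] := rotation_bound c; rewrite /df (le_trans (ler_normB _ _)) //.
by rewrite !normrM mulr_natl mulr2n expr2 lerD // ler_pM.
Qed.

(** On a cylinder around the axis the system reduces to the angle, at [true], and
    the height above [E1], at [false]; unlike the original one it is globally
    Lipschitz. *)
Definition polar_rhs (u : bool -> R) (i : bool) : R :=
  if i then 1 / d + u false else - d * u false + X (u true) * Y (u true).

Definition polar_lip : R := 1 + `|d| + 2 * m ^+ 2.

Lemma polar_lip_gt0 : 0 < polar_lip.
Proof.
apply: ltr_wpDr; first by rewrite mulr_ge0 // sqr_ge0.
exact: ltr_wpDr.
Qed.

Lemma polar_lipschitz (a b : bool -> R) (i : bool) :
  `|polar_rhs a i - polar_rhs b i| <= polar_lip * \sum_j `|a j - b j|.
Proof.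
rewrite big_bool /polar_lip.
have A := normr_ge0 (a true - b true); have B := normr_ge0 (a false - b false).
have D := normr_ge0 d; have M := sqr_ge0 m.
have p1 := mulr_ge0 D A; have p2 := mulr_ge0 M A.
have p3 := mulr_ge0 D B; have p4 := mulr_ge0 M B.
case: i => /=.
  rewrite opprD addrACA subrr add0r; lra.
have -> : - d * a false + X (a true) * Y (a true) -
    (- d * b false + X (b true) * Y (b true)) = - d * (a false - b false) +
    (X (a true) * Y (a true) - X (b true) * Y (b true)) by ring.
rewrite (le_trans (ler_normD _ _)) //.
have := forcing_lipschitz (a true) (b true); rewrite normrM normrN; lra.
Qed.

(** The last clause is the periodicity: after a full turn that brings [w] back to
    its initial value, the shifted solution solves the same Cauchy problem. *)
Lemma polar_solution : exists ph w : R -> R,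
  [/\ ph 0 = 0, w 0 = w0, forall t : R, is_derive t (1 : R) ph (1 / d + w t),
      (forall t : R, is_derive t (1 : R) w (- d * w t + X (ph t) * Y (ph t)))
    & forall T k, X k = x0 -> Y k = y0 -> cos k = 1 -> sin k = 0 ->
        ph T = k -> w T = w0 ->
        forall t, ph (t + T) = ph t + k /\ w (t + T) = w t].
Proof.
have [u [u' u0]] := picard_lindelof polar_lip_gt0 polar_lipschitz
  (fun i : bool => if i then 0 else w0).
exists (u true), (u false); split.
- by rewrite u0.
- by rewrite u0.
- by move=> t; exact: u' true t.
- by move=> t; exact: u' false t.
move=> T k Xk Yk ck sk phT wT.
pose v (i : bool) (t : R) : R := if i then u true (t + T) - k else u false (t + T).
have sh (i : bool) (t : R) :
    is_derive t (1 : R) (fun s => u i (s + T)) (polar_rhs (u ^~ (t + T)) i).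
  have shift : is_derive t (1 : R) (fun s => s + T) (1 + 0).
    exact: der_D (der_id t) (der_cst t 1 T).
  by apply: der_eq (der_comp (u' i _) shift) _; rewrite addr0 mulr1.
have v' : integral_curve polar_rhs v.
  move=> [] t /=.
    apply: der_eq (der_D (sh true t) (der_cst t 1 (- k))) _.
    by rewrite addr0 /polar_rhs /v.
  have vf : v false = fun s => u false (s + T) by [].
  rewrite vf; apply: der_eq (sh false t) _; rewrite /polar_rhs /v; congr (_ + _).
  by rewrite /X /Y cosB sinB ck sk; ring.
have vu : v = u.
  apply: (integral_curve_unique polar_lip_gt0 polar_lipschitz v' u').
  by case; rewrite /v add0r u0 ?phT ?wT ?subrr.
move=> t; have ht := congr1 (fun f => f true t) vu; have hf := congr1 (fun f => f false t) vu.
by split=> //; rewrite -ht /v /= subrK.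
Qed.

End CenterDynamics.

Section Center.
Variables (R : realType) (d : R).
Hypothesis d_neq0 : d != 0.
Local Notation E := 'rV[R]_3.
Local Notation f := (vfield 0 0 0 d).
Local Notation p := (E1 d).

Lemma E1_coords : [/\ (p : E) 0 0 = 0, (p : E) 0 1 = 0 & (p : E) 0 2 = 1 / d].
Proof. by rewrite !mxE. Qed.

Lemma vertical_coords (x y z : R) : [/\ vertical x y z 0 0 = x,
  vertical x y z 0 1 = y & vertical x y z 0 2 = z].
Proof. by rewrite !mxE. Qed.

(** [d * ph] grows at a rate of at least 1/2. *)
Lemma angle_onto (ph w : R -> R) : ph 0 = 0 ->
  (forall t : R, is_derive t (1 : R) ph (1 / d + w t)) ->
  (forall t, `|d * w t| <= 1 / 2) ->
  (forall s t, s < t -> d * ph s < d * ph t) /\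
  (forall y, 0 <= y -> exists2 t, 0 <= t & d * ph t = y).
Proof.
move=> ph0 ph' dw; pose psi (t : R) : R := d * ph t.
have psi' (t : R) : is_derive t (1 : R) psi (1 + d * w t).
  by have pt := ph' t; rewrite /psi; derive_tac; field.
have ge_half t : 1 / 2 <= 1 + d * w t.
  by have := dw t; rewrite ler_norml => /andP[]; lra.
split=> [s t st|y y0].
  have [c _ e] := is_derive_MVT psi' (ltW st).
  rewrite -subr_gt0 -/(psi s) -/(psi t) e mulr_gt0 ?subr_gt0 //.
  by apply: lt_le_trans (ge_half c); rewrite divr_gt0.
have y2 : 0 <= 2 * y by rewrite mulr_ge0.
have psic : {within `[0, 2 * y], continuous psi}.
  by apply: continuous_subspaceT => t; exact: is_derive_continuous (psi' t).
have psi0 : psi 0 = 0 by rewrite /psi ph0 mulr0.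
have [|t t0 ty] := @IVT R psi 0 (2 * y) y y2 psic; last first.
  by exists t => //; move: t0; rewrite in_itv /= => /andP[].
have [c _ e] := is_derive_MVT psi' y2; rewrite psi0 !subr0 in e.
rewrite psi0 ge_min y0 /= le_max; apply/orP; right.
by rewrite e; have := ler_wpM2r y2 (ge_half c); lra.
Qed.

(** Orbits on [W] stay on a cylinder and, by local invariance, on the graph [W],
    so their height stays small, their angle makes full turns, and after a full
    turn the height is the initial one. The orbit is the intersection of [W] with
    the cylinder and bounds the part of [W] inside it. *)
Lemma center_bc0 r (W : set E) : C_surface r.+1 W -> W p ->
  (forall v : E, v 0 2 = 0 -> tangent_space W p v) ->
  locally_invariant f p W -> center_on f p W.
Proof.
move=> Ws Wp tW [Ui [Uio Uip inv]] N pN.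
have [p0 p1 p2] := E1_coords.
have ad : 0 < `|d|^-1 by rewrite invr_gt0 normr_gt0.
pose M : set E := [set q | N q /\ Ui q].
have pM : nbhs p M by apply: filterI => //; exact: open_nbhs_nbhs.
have pM' : nbhs p [set q : E | M q /\ forall j, `|q 0 j - p 0 j| < `|d|^-1 / 2].
  by apply: filterI => //; apply: nbhs_box; rewrite divr_gt0.
have [dl [et [dl0 et0 boxN Winj [Whalf Wcpt]]]] := local_graph Ws Wp tW pM'.
have boxE (q : E) : box p dl et q <->
    [/\ `|q 0 0| <= dl, `|q 0 1| <= dl & `|q 0 2 - 1 / d| <= et].
  by rewrite /box /= p0 p1 p2 !subr0.
have boxp : box p dl et p.
  by rewrite /box /= !subrr normr0 !ltW.
have etd : `|d| * et <= 1 / 2.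
  have : box p dl et (vertical 0 0 (1 / d + et)).
    apply/boxE; have [-> -> ->] := vertical_coords 0 0 (1 / d + et).
    by rewrite normr0 addrC addKr (ger0_norm (ltW et0)) (ltW dl0).
  move=> /boxN [_ /(_ 2)]; have [_ _ ->] := vertical_coords 0 0 (1 / d + et).
  rewrite p2 addrC addKr (ger0_norm (ltW et0)) => H.
  have : `|d| * et <= `|d| * (`|d|^-1 / 2) by rewrite ler_wpM2l // ltW.
  by rewrite mulrA divff ?normr_eq0.
pose V : set E := [set q | forall j, `|q 0 j - p 0 j| < Num.min (dl / 2) et].
exists V; split; first by apply: nbhs_box; rewrite lt_min divr_gt0.
move=> q Wq Vq qp.
have q0 : `|q 0 0| < dl / 2.
  by have := Vq 0; rewrite p0 subr0 lt_min => /andP[].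
have q1 : `|q 0 1| < dl / 2.
  by have := Vq 1; rewrite p1 subr0 lt_min => /andP[].
have q2 : `|q 0 2 - 1 / d| < et.
  by have := Vq 2; rewrite p2 lt_min => /andP[].
have boxq : box p dl et q by apply/boxE; split; apply: ltW => //; lra.
have q2h : `|q 0 2 - 1 / d| < et / 2 by rewrite -p2; apply: Whalf.
pose x0 := q 0 0; pose y0 := q 0 1; pose w0 := q 0 2 - 1 / d.
pose rho := x0 ^+ 2 + y0 ^+ 2.
have rho_neq0 : rho != 0.
  rewrite /rho paddr_eq0 ?sqr_ge0 // !sqrf_eq0; apply/negP => /andP[/eqP xz /eqP yz].
  by apply: qp; apply: Winj => //; rewrite ?p0 ?p1.
have rho_gt0 : 0 < rho by rewrite lt_def rho_neq0 addr_ge0 ?sqr_ge0.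
have rho_dl : rho <= dl ^+ 2.
  have dl2 : 0 <= dl / 2 by rewrite divr_ge0 // ltW.
  have a : x0 ^+ 2 <= (dl / 2) ^+ 2.
    by rewrite -real_normK ?num_real // ler_sqr ?nnegrE // ltW.
  have b : y0 ^+ 2 <= (dl / 2) ^+ 2.
    by rewrite -real_normK ?num_real // ler_sqr ?nnegrE // ltW.
  by rewrite /rho; have := sqr_ge0 dl; lra.
have disc_box (x y : R) : x ^+ 2 + y ^+ 2 <= rho -> `|x| <= dl /\ `|y| <= dl.
  move=> xy; split; rewrite -ler_sqr ?nnegrE ?(ltW dl0) // real_normK ?num_real //.
    by have := sqr_ge0 y; lra.
  by have := sqr_ge0 x; lra.
have [ph [w [ph0 w_0 ph' w' per]]] := @polar_solution R d x0 y0 w0.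
pose X (s : R) : R := x0 * cos s + y0 * sin s.
pose Y (s : R) : R := y0 * cos s - x0 * sin s.
pose g (t : R) : E := vertical (X (ph t)) (Y (ph t)) (1 / d + w t).
have gc t : [/\ g t 0 0 = X (ph t), g t 0 1 = Y (ph t) & g t 0 2 = 1 / d + w t].
  exact: vertical_coords.
have gr t : g t 0 0 ^+ 2 + g t 0 1 ^+ 2 = rho.
  by have [-> -> _] := gc t; exact: rotation_radius.
have sol : solution_on f setT g.
  move=> t _; have phd := ph' t; have wd := w' t.
  have Xd := der_comp (der_X x0 y0 (ph t)) phd.
  have Yd := der_comp (der_Y x0 y0 (ph t)) phd.
  have [g0 g1 g2] := gc t.
  apply: is_derive_rV => -[[|[|[|//]]] j3]; rewrite !mxE /=.
  - rewrite (_ : (fun s => g s 0 _) = fun s => X (ph s)); last first.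
      by apply/funext => s; rewrite mxE.
    by apply: der_eq Xd _; rewrite /X /Y; ring.
  - rewrite (_ : (fun s => g s 0 _) = fun s => Y (ph s)); last first.
      by apply/funext => s; rewrite mxE.
    by apply: der_eq Yd _; rewrite /X /Y; ring.
  - rewrite (_ : (fun s => g s 0 _) = fun s => 1 / d + w s); last first.
      by apply/funext => s; rewrite mxE.
    apply: der_eq (der_D (der_cst t 1 (1 / d)) wd) _; rewrite /X /Y.
    by field.
have g0q : g 0 = q.
  rewrite [RHS]vertical_eta /g ph0 w_0 /X /Y cos0 sin0 /w0.
  by rewrite !mulr1 !mulr0 addr0 subr0 subrKC.
have wcont : continuous w by move=> t; exact: is_derive_continuous (w' t).
have inbox t : `|w t| <= et -> box p dl et (g t).
  move=> wt; apply/boxE.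
  have [|xd yd] := disc_box (g t 0 0) (g t 0 1); first by rewrite gr.
  by split=> //; have [_ _ ->] := gc t; rewrite addrC addKr.
have inW s : 0 < s -> (forall u, `|u| < s -> `|w u| < et) ->
    forall u, `|u| < s -> W (g u).
  move=> s0 sw u us; have s1 : - s < 0 by rewrite oppr_lt0.
  apply: (inv g (- s) s s1 s0); rewrite ?g0q //.
  - by move=> t _; exact: sol.
  - by move=> t; rewrite -ltr_norml => /sw /ltW /inbox /boxN [[]].
  - by rewrite -ltr_norml.
have whalf t : `|w t| <= et / 2.
  apply: (@confined R w (et / 2) et wcont) => [||s s0 sw u us].
  - by lra.
  - by rewrite w_0.
  - have Wu := inW s s0 sw u us; have Bu := inbox u (ltW (sw u us)).
    have := Whalf (g u) (conj Wu Bu); have [_ _ ->] := gc u.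
    by rewrite p2 addrC addKr => /ltW.
have wet t : `|w t| < et by apply: le_lt_trans (whalf t) _; lra.
have gW t : W (g t).
  apply: (inW (`|t| + 1)) => [|u _|]; [by rewrite ltr_wpDl | exact: wet |].
  by rewrite ltrDl.
have gB t : box p dl et (g t) by apply/inbox/ltW.
have dw t : `|d * w t| <= 1 / 2.
  by rewrite normrM (le_trans _ etd) // ler_wpM2l // ltW.
have [phm phs] := angle_onto ph0 ph' dw.
have same t t' : X (ph t) = X (ph t') -> Y (ph t) = Y (ph t') -> g t = g t'.
  move=> Xt Yt; apply: Winj; [by split | by split | |].
    by have [-> _ _] := gc t; have [-> _ _] := gc t'.
  by have [_ -> _] := gc t; have [_ -> _] := gc t'.
have X0 : X 0 = x0 by rewrite /X cos0 sin0 mulr1 mulr0 addr0.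
have Y0 : Y 0 = y0 by rewrite /Y cos0 sin0 mulr1 mulr0 subr0.
have dd : d * Num.sg d = `|d| by rewrite mulrC -normrEsg.
(* One full turn, run in the direction given by the sign of [d]. *)
pose k := Num.sg d * (2 * pi).
have dk : d * k = `|d| * (2 * pi) by rewrite /k mulrA dd.
have [ck sk] : cos k = 1 /\ sin k = 0.
  rewrite /k; case: sgrP d_neq0 => // _ _.
    by rewrite mul1r mulr_natl cos2pi sin2pi.
  by rewrite mulN1r cosN sinN mulr_natl cos2pi sin2pi oppr0.
have Xk : X k = x0 by rewrite /X ck sk mulr1 mulr0 addr0.
have Yk : Y k = y0 by rewrite /Y ck sk mulr1 mulr0 subr0.
have tp : 0 < 2 * pi :> R by rewrite mulr_gt0 // pi_gt0.
have dp : 0 < `|d| * (2 * pi) by rewrite mulr_gt0 // normr_gt0.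
have [T T0 phT] := phs _ (ltW dp).
have {}phT : ph T = k by apply: (mulfI d_neq0); rewrite phT dk.
have T_gt0 : 0 < T.
  rewrite lt_def T0 andbT; apply/eqP => Tz; move: dp.
  by rewrite -dk -phT Tz ph0 mulr0 ltxx.
have gT0 : g T = g 0 by apply: same; rewrite phT ph0 ?X0 ?Y0.
have wT : w T = w0.
  have [_ _ a] := gc T; have [_ _ b] := gc 0.
  by apply: (addrI (1 / d)); rewrite -a gT0 b w_0.
have perT := per T k Xk Yk ck sk phT wT.
have gT t : g (t + T) = g t.
  have [pt wt] := perT t; rewrite /g pt wt /X /Y cosD sinD ck sk.
  by rewrite !mulr1 !mulr0 subr0 addr0.
have circle x y : x ^+ 2 + y ^+ 2 = rho -> exists t, X (ph t) = x /\ Y (ph t) = y.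
  move=> xy; have [al alpi [Xa Ya]] := rotation_onto rho_neq0 xy.
  (* The extra turn makes the target angle positive in the direction of [d]. *)
  have [|t t0 dt] := phs (d * (al + k)).
    rewrite mulrDr dk; have : - (d * al) <= `|d| * pi.
      by apply: le_trans (ler_norm _) _; rewrite normrN normrM ler_wpM2l.
    have : 0 <= `|d| * pi by rewrite mulr_ge0 // pi_ge0.
    lra.
  exists t; have -> : ph t = al + k by apply: (mulfI d_neq0).
  by rewrite -Xa -Ya /X /Y cosD sinD ck sk; split; ring.
exists g, T; split=> //.
  split=> // s /andP[s0 sT] gs.
  have [Xs Ys] : X (ph s) = x0 /\ Y (ph s) = y0.
    have [a b _] := gc s; have [a' b' _] := gc 0.
    by rewrite -a -b gs a' b' ph0 X0 Y0.
  have [n nE] := cos_eq1_2pi (rotation_fixed rho_neq0 Xs Ys).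
  have l1 := phm _ _ s0; have l2 := phm _ _ sT.
  rewrite ph0 mulr0 in l1; rewrite phT dk in l2.
  have : 0 < `|d * ph s| < `|d| * (2 * pi) by rewrite gtr0_norm // l1.
  have -> : `|d * ph s| = `|n|%:~R * (`|d| * (2 * pi)).
    by rewrite nE 2!normrM (@ger0_norm _ (2 * pi)) ?(ltW tp) // intr_norm; ring.
  rewrite gtr_pMl // pmulr_lgt0 //.
  by rewrite -[1]/(1%:~R) ltr_int ltr0z; case: `|n|%R => [[|[|]]|].
pose disc : set E := [set u | u 0 0 ^+ 2 + u 0 1 ^+ 2 <= rho].
have rc : continuous (fun u : E => u 0 0 ^+ 2 + u 0 1 ^+ 2).
  have xd (u : E) i : differentiable (fun u : E => u 0 i) u.
    exact: differentiable_coord.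
  have rd (u : E) : differentiable (fun u : E => u 0 0 * u 0 0 + u 0 1 * u 0 1) u.
    by apply: differentiableD; apply: differentiableM; exact: xd.
  by move=> u; exact: differentiable_continuous (rd u).
have on_orbit u : (W `&` box p dl et) u -> u 0 0 ^+ 2 + u 0 1 ^+ 2 = rho ->
    range g u.
  move=> Wu ur; have [t [Xt Yt]] := circle _ _ ur; exists t => //.
  have [a b _] := gc t.
  by apply: Winj; [split; [exact: gW | exact: gB] | | rewrite a | rewrite b].
exists ((W `&` box p dl et) `&` disc); split.
- apply: compact_closedI => //.
  exact: (closed_comp (fun u _ => rc u) (@closed_le R rho)).
- by move=> u [[Wu Bu] _]; split=> //; have [[]] := boxN u Bu.
- by move=> _ [t _ <-]; split; [split; [exact: gW | exact: gB] | rewrite /disc /= gr].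
- split; first by split=> //; rewrite /disc /= p0 p1 expr0n /= addr0 ltW.
  move=> [t _ gtp]; have := gr t.
  by rewrite gtp p0 p1 expr0n /= addr0 => r0; rewrite -r0 eqxx in rho_neq0.
exists ([set u : E | u 0 0 ^+ 2 + u 0 1 ^+ 2 < rho] `&` [set u : E | `|u 0 2 - 1 / d| < et]).
split.
  apply: openI.
    exact: (open_comp (fun u _ => rc u) (@open_lt R rho)).
  have zc : continuous (fun u : E => u 0 2) by exact: coord_continuous.
  rewrite (_ : [set u : E | _] = (fun u : E => u 0 2) @^-1` `]1 / d - et, 1 / d + et[).
    by apply: open_comp; [move=> u _; exact: zc | exact: interval_open].
  by apply/seteqP; split=> u /=; rewrite in_itv /= ltr_distl.
apply/seteqP; split=> u.
  move=> [[[Wu Bu] ur] ng]; split=> //; split.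
    rewrite /= lt_neqAle; apply/andP; split=> //.
    by apply/eqP => ur'; apply: ng; apply: on_orbit.
  have := Whalf u (conj Wu Bu); rewrite p2 /=; lra.
move=> [Wu [ur uw]]; split.
  split; last exact: ltW.
  split=> //; apply/boxE; have [a b] := disc_box _ _ (ltW ur).
  by split=> //; exact: ltW.
by move=> [t _ gtu]; move: ur; rewrite /= -gtu gr ltxx.
Qed.
End Center.

(** * The Hopf point, its center and its period *)

Theorem theorem1 (R : realType) (a b c d : R) :
  d != 0 -> a = c -> (1 + c * d) * (1 - b * d) - c ^+ 2 * d ^+ 2 > 0 ->
  hopf_point (vfield a b c d) (E1 d) /\
  forall (r : nat) (W : set 'rV[R]_3), (1 <= r)%N ->
    center_manifold r (vfield a b c d) (E1 d) W ->
    (center_on (vfield a b c d) (E1 d) W <-> b = 0 /\ c = 0) /\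
    (b = 0 /\ c = 0 -> ~ isochronous_center_on (vfield a b c d) (E1 d) W).
Proof.
move=> d0 -> {a} disc; split; first exact: hopf_point_E1.
move=> [|r] W // _ [Wp Ws tW inv]; split; last first.
  by move=> [b0 c0]; subst b c; exact: not_isochronous.
split; first exact: center_forces_bc0.
move=> [b0 c0]; subst b c; apply: (center_bc0 d0 Ws Wp _ inv) => v v2.
by rewrite tW; exact: center_plane_E1.
Qed.
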